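(* Let $G_m$ be a bounded Vilenkin group. (a) Let $\{q_k:k\ge 0\}$ be a non-increasing sequence of non-negative numbers with $q_0>0$, let $T_n$ be the associated $T$ means and let $T^*f=\sup_{n\in\mathbb N_+}|T_nf|$. Then $T^*$ is bounded from the Hardy space $H_{1/2}(G_m)$ to the space weak-$L_{1/2}(G_m)$; that is, there is a constant $C$ such that $\|T^*f\|_{weak-L_{1/2}}\le C\|f\|_{H_{1/2}}$ for all $f\in H_{1/2}(G_m)$. (b) Let $0<p<1/2$ and let $\{q_k:k\ge 0\}$ be a non-increasing sequence of non-negative numbers with $q_0>0$ for which there is a constant $c>0$ such that $$\frac{q_{n+1}}{Q_{n+2}}\ge \frac{c}{n}\qquad\text{for all } n\in\mathbb N_+ .$$ Then there exists a martingale $f\in H_p(G_m)$ such that $$\sup_{n\in\mathbb N_+}\|T_nf\|_{weak-L_p}=\infty .$$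
   Context: Notation: $\mathbb N_+=\{1,2,\dots\}$, $\mathbb N=\mathbb N_+\cup\{0\}$. Let $m=(m_0,m_1,\dots)$ be a sequence of integers $m_k\ge 2$ with $\sup_k m_k<\infty$ (bounded case). $Z_{m_k}=\{0,\dots,m_k-1\}$ is the additive group of integers modulo $m_k$ with the discrete topology, and $G_m=\prod_{k\ge 0}Z_{m_k}$ with the product topology and the product measure $\mu$ of the uniform measures $\mu_k(\{j\})=1/m_k$ (normalized Haar measure). Elements are $x=(x_0,x_1,\dots)$ with $x_j\in Z_{m_j}$. Put $I_0(x)=G_m$, $I_n(x)=\{y\in G_m: y_0=x_0,\dots,y_{n-1}=x_{n-1}\}$. Put $M_0=1$, $M_{k+1}=m_kM_k$; each $n\in\mathbb N$ is uniquely $n=\sum_{j\ge 0}n_jM_j$ with $n_j\in Z_{m_j}$, finitely many nonzero. Generalized Rademacher functions: $r_k(x)=\exp(2\pi i x_k/m_k)$. Vilenkin system: $\psi_n(x)=\prod_{k\ge 0}r_k^{n_k}(x)$, $n\in\mathbb N$. For measurable $f$ and $0<p<\infty$: $\|f\|_{weak-L_p}^p=\sup_{\lambda>0}\lambda^p\mu(|f|>\lambda)$. Let $\mathcal F_n$ be the $\sigma$-algebra generated by $\{I_n(x):x\in G_m\}$. A martingale $f=(f^{(n)},n\in\mathbb N)$ is a martingale with respect to $(\mathcal F_n)$. For $0<p<\infty$, $H_p(G_m)$ consists of all martingales $f$ with $\|f\|_{H_p}:=\|f^*\|_p<\infty$, where $f^*=\sup_n|f^{(n)}|$ and $\|g\|_p=(\int_{G_m}|g|^pd\mu)^{1/p}$.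 The Vilenkin–Fourier coefficients of a martingale $f$ are $\widehat f(i)=\lim_{k\to\infty}\int_{G_m}f^{(k)}\overline{\psi}_i\,d\mu$, and the partial sums are $S_nf=\sum_{k=0}^{n-1}\widehat f(k)\psi_k$ for $n\in\mathbb N_+$, with $S_0f=0$. Given the sequence $\{q_k\}$, put $Q_n=\sum_{k=0}^{n-1}q_k$. The $T$ means are $T_nf=\frac1{Q_n}\sum_{k=0}^{n-1}q_kS_kf$, $n\in\mathbb N_+$. *)

(* Defs.v *)
From HB Require Import structures.
From mathcomp Require Import all_boot all_order all_algebra.
From mathcomp Require Import complex.
From mathcomp Require Import all_classical all_reals all_analysis.

Set Implicit Arguments.
Unset Strict Implicit.
Unset Printing Implicit Defensive.

Import Order.TTheory GRing.Theory Num.Theory.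
Import numFieldTopology.Exports numFieldNormedType.Exports.

Local Open Scope classical_set_scope.
Local Open Scope ring_scope.
Local Open Scope complex_scope.

Definition bounded_vilenkin (m : nat -> nat) : Prop :=
  (forall k, (2 <= m k)%N) /\ (exists N, forall k, (m k <= N)%N).

(* 'Z_(m k) is the group of integers modulo m k under the standing assumption
   2 <= m k. *)
Definition vseq (m : nat -> nat) : Type := forall k, 'Z_(m k).

HB.instance Definition _ m := Choice.on (vseq m).
HB.instance Definition _ m := isPointed.Build (vseq m) (fun=> 0).

Definition cylinder (m : nat -> nat) (n : nat) (x : vseq m) : set (vseq m) :=
  [set y | forall k, (k < n)%N -> y k = x k].

Definition cylinders (m : nat -> nat) : set (set (vseq m)) :=
  [set I | exists n x, I = @cylinder m n x].
Arguments cylinders : clear implicits.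

(* The cylinders form a countable base of the product topology, so that
   <<s cylinders m >> is its Borel sigma-algebra. *)
Definition vgroup (m : nat -> nat) := g_sigma_algebraType (cylinders m).
HB.instance Definition _ m := Measurable.on (vgroup m).

Definition vfiltration (m : nat -> nat) (n : nat) : set (set (vgroup m)) :=
  <<s [set cylinder n x | x in [set: vseq m]] >>.
Arguments vfiltration : clear implicits.

(* mu is the product of the uniform measures A |-> #|A| / m_k; measurable
   rectangles form a pi-system, so there is only one such mu. *)
Definition is_product_measure (R : realType) (m : nat -> nat)
    (mu : probability (vgroup m) R) : Prop :=
  forall (n : nat) (A : forall k, {set 'Z_(m k)}),
    mu [set x : vseq m | forall k, (k < n)%N -> x k \in A k] =
    (\prod_(k < n) (#|A k|%:R / (m k)%:R))%:E.

Definition vbase (m : nat -> nat) (k : nat) : nat := \prod_(j < k) m j.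

Definition vdigit (m : nat -> nat) (n k : nat) : nat :=
  ((n %/ vbase m k) %% m k)%N.

Lemma vbase_gt0 m k : (forall j, (2 <= m j)%N) -> (0 < vbase m k)%N.
Proof. by move=> m2; apply: prodn_gt0 => j; exact: ltnW (m2 j). Qed.

Lemma vbase_gt m k : (forall j, (2 <= m j)%N) -> (k < vbase m k)%N.
Proof.
move=> m2; apply: leq_trans (ltn_expl k (leqnn 2)) _.
rewrite -[k in (2 ^ k)%N]card_ord -prod_nat_const.
by apply: leq_prod => j _; exact: m2.
Qed.

Lemma vdigit_eq0 m n k : (forall j, (2 <= m j)%N) -> (n <= k)%N ->
  vdigit m n k = 0%N.
Proof.
by move=> m2 nk; rewrite /vdigit divn_small ?mod0n// (leq_ltn_trans nk)// vbase_gt.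
Qed.

Lemma vdigit_sum m n : (forall j, (2 <= m j)%N) ->
  n = (\sum_(j < n) vdigit m n j * vbase m j)%N.
Proof.
move=> m2; suff H k : (n %% vbase m k = \sum_(j < k) vdigit m n j * vbase m j)%N.
  by rewrite -H modn_small ?vbase_gt.
elim: k => [|k IH]; first by rewrite big_ord0 /vbase big_ord0 modn1.
rewrite big_ord_recr/= -IH /vdigit {1}/vbase big_ord_recr/= -/(vbase m k).
rewrite [in LHS](divn_eq n (vbase m k)) addnC.
rewrite [in LHS](divn_eq (n %/ vbase m k) (m k)) mulnDl addnCA -mulnA (mulnC (m k)).
rewrite modnMDl modn_small; first by rewrite addnC.
have M0 := @vbase_gt0 m k m2.
have : ((n %/ vbase m k) %% m k < m k)%N by rewrite ltn_mod (ltnW (m2 k)).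
move=> h; apply: (@leq_trans (((n %/ vbase m k) %% m k).+1 * vbase m k)%N).
  by rewrite mulSn ltn_add2r ltn_mod.
by rewrite mulnC leq_mul2l h orbT.
Qed.

(* The measure is the image of Lebesgue measure on [0, 1) under the expansion
   t = \sum_k x_k / M_(k+1). *)
Section product_measure_exists.
Variables (R : realType) (m : nat -> nat) (hm : forall k, (2 <= m k)%N).

Let I01 : set R := `[0, 1[%classic.

Let mI : measurable I01. Proof. exact: measurable_itv. Qed.

Let M k : R := (vbase m k)%:R.

Let M_gt0 k : 0 < M k. Proof. by rewrite ltr0n vbase_gt0. Qed.

Let M_ge0 k : 0 <= M k. Proof. exact: ltW. Qed.

Let MS k : M k.+1 = M k * (m k)%:R.
Proof. by rewrite /M /vbase big_ord_recr/= natrM. Qed.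

Let dg (t : R) (k : nat) : nat := (Num.truncn (t * M k.+1) %% m k)%N.

Let digits (t : R) : vgroup m :=
  fun k => if t \in I01 then inZp (dg t k) else 0.

Let digitsE t k : I01 t -> digits t k = dg t k :> nat.
Proof.
move=> It; rewrite /digits mem_set//= Zp_cast// modn_small// ltn_mod.
exact: ltnW.
Qed.

Let idx (x : vseq m) (n : nat) : nat :=
  iteri n (fun k a => a * m k + x k)%N 0%N.

Let idxP x n t : I01 t ->
  cylinder n x (digits t) <-> Num.truncn (t * M n) = idx x n.
Proof.
move=> It; have t01 : 0 <= t < 1 by move: It; rewrite /I01/= in_itv.
have t0 : 0 <= t by case/andP: t01.
have xm k : (x k < m k)%N by have := ltn_ord (x k); rewrite [X in (_ < X)%N -> _]Zp_cast.
elim: n => [|n IH].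
  split => // _; apply/eqP; rewrite truncn_eq ?mulr_ge0//.
  by rewrite /M /vbase big_ord0 mulr1; case/andP: t01.
have eq_div : Num.truncn (t * M n) = (Num.truncn (t * M n.+1) %/ m n)%N.
  apply/eqP; rewrite truncn_eq ?mulr_ge0//.
  have mn0 : 0 < (m n)%:R :> R by rewrite ltr0n ltnW.
  have /truncn_itv : 0 <= t * M n.+1 by rewrite mulr_ge0.
  set N := Num.truncn _ => /andP[N1 N2]; apply/andP; split.
    rewrite -(ler_pM2r mn0) -mulrA -MS (le_trans _ N1)// -natrM ler_nat.
    exact: leq_divM.
  rewrite -(ltr_pM2r mn0) -mulrA -MS (lt_le_trans N2)// -natrM ler_nat.
  by rewrite ltn_ceil// ltnW.
have eqN := divn_eq (Num.truncn (t * M n.+1)) (m n).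
rewrite -eq_div in eqN.
have -> : idx x n.+1 = (idx x n * m n + x n)%N by [].
split=> [c|c].
  rewrite eqN -/(dg t n) -(digitsE n It) c// (proj1 IH)// => k kn; apply: c.
  exact: ltnW.
have idn : Num.truncn (t * M n) = idx x n.
  by rewrite eq_div c divnMDl ?divn_small ?addn0// ltnW.
move=> k; rewrite ltnS leq_eqVlt => /predU1P[->|kn].
  by apply: val_inj => /=; rewrite digitsE// /dg c modnMDl modn_small.
by apply/(proj2 IH).
Qed.

Let preim (x : vseq m) n : (digits @^-1` cylinder n x) `&` I01 =
  `[(idx x n)%:R / M n, (idx x n).+1%:R / M n[%classic.
Proof.
have xm k : (x k < m k)%N by have := ltn_ord (x k); rewrite [X in (_ < X)%N -> _]Zp_cast.
have idxlt : (idx x n < vbase m n)%N.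
  elim: n => [|n IH]; first by rewrite /vbase big_ord0.
  rewrite /vbase big_ord_recr/= -/(vbase m n) -/(idx x n).
  apply: (@leq_trans ((idx x n).+1 * m n)%N); last by rewrite leq_mul2r IH orbT.
  by rewrite mulSn addnC ltn_add2r.
apply/seteqP; split=> t /=.
  move=> [c It]; have t01 : 0 <= t < 1 by move: It; rewrite /I01/= in_itv.
  have t0 : 0 <= t by case/andP: t01.
  move/(idxP x n It): c => /eqP; rewrite truncn_eq ?mulr_ge0//.
  by rewrite in_itv/= ler_pdivrMr// ltr_pdivlMr.
rewrite in_itv/= ler_pdivrMr// ltr_pdivlMr// => /andP[t1 t2].
have t0 : 0 <= t by rewrite -(pmulr_lge0 _ (M_gt0 n)); apply: le_trans t1.
have It : I01 t.
  rewrite /I01/= in_itv/= t0/= -(ltr_pM2r (M_gt0 n)) mul1r (lt_le_trans t2)//.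
  by rewrite ler_nat.
split=> //; apply/(idxP x n It)/eqP.
by rewrite truncn_eq ?t1// mulr_ge0.
Qed.

Let digits_measurable : measurable_fun [set: measurableTypeR R] digits.
Proof.
apply: (@measurability _ _ (measurableTypeR R) (vgroup m) setT digits (cylinders m)) => // _ [_ [n [x ->]] <-].
rewrite setTI -(setIT (digits @^-1` _)) -(setUv I01) setIUr preim.
apply: measurableU; first exact: measurable_itv.
have [c|c] := pselect (cylinder n x (fun=> 0)).
  rewrite (_ : _ `&` _ = ~` I01); first exact: measurableC.
  apply/seteqP; split=> [t []//|t nt]; split => //= k kn.
  by rewrite /digits memNset// -c.
rewrite (_ : _ `&` _ = set0)//; apply/seteqP; split=> // t [ct nt]; apply: c.
by move=> k kn; rewrite -ct// /digits memNset.
Qed.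

Let prm : set (vgroup m) -> \bar R :=
  pushforward (mrestr (@lebesgue_measure R) mI) digits.

Let prm0 : prm set0 = 0%E. Proof. exact: measure0. Qed.

Let prm_ge0 A : (0 <= prm A)%E.
Proof. exact: measure_ge0. Qed.

Let prm_sigma_additive : semi_sigma_additive prm.
Proof.
have mU F : measurable F -> measurable (digits @^-1` F).
  by rewrite -[X in _ -> measurable X]setTI; apply: digits_measurable.
move=> F mF tF mUF; rewrite /prm /pushforward preimage_bigcup.
apply: measure_semi_sigma_additive => [n||]; first exact: mU.
- apply/trivIsetP => /= i j _ _ ij; rewrite -preimage_setI.
  by move/trivIsetP : tF => /(_ _ _ _ _ ij) ->//; rewrite preimage_set0.
- by rewrite -preimage_bigcup; exact: mU.
Qed.

HB.instance Definition _ :=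
  isMeasure.Build _ _ _ prm prm0 prm_ge0 prm_sigma_additive.

Let prm_cyl x n : prm (cylinder n x) = ((M n)^-1)%:E.
Proof.
rewrite /prm /pushforward/= /mrestr preim lebesgue_measure_itv/= lte_fin.
rewrite ltr_pM2r ?invr_gt0// ltr_nat ltnSn -EFinB -mulrBl -natrB// subSnn.
by rewrite mul1r.
Qed.

Let prm_setT : prm [set: vgroup m] = 1%:E.
Proof.
have -> : [set: vgroup m] = cylinder 0 (fun=> 0) by apply/seteqP; split.
by rewrite prm_cyl /M /vbase big_ord0 invr1.
Qed.

HB.instance Definition _ := Measure_isProbability.Build _ _ _ prm prm_setT.

Let measurable_cylinder n x : measurable (cylinder n x : set (vgroup m)).
Proof. by apply: sub_gen_smallest; exists n, x. Qed.

Let rect n (A : forall k, {set 'Z_(m k)}) : set (vgroup m) :=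
  [set x : vseq m | forall k, (k < n)%N -> x k \in A k].

Let rectS n j (A : forall k, {set 'Z_(m k)}) : (j < n)%N ->
  rect n A = \big[setU/set0]_(v : 'Z_(m j))
    (if v \in A j then rect n (dfwith A j [set v]%SET) else set0).
Proof.
move=> jn; apply/seteqP; split=> [x Ax|x].
  rewrite -bigcup_seq; exists (x j) => /=; first by rewrite mem_index_enum.
  rewrite Ax// => k kn; have [<-|jk] := eqVneq j k.
    by rewrite dfwithin finset.in_set1.
  by rewrite dfwithout// Ax.
rewrite -bigcup_seq => -[v _]; case: ifP => //= vA Ax k kn.
have := Ax _ kn; have [<-|jk] := eqVneq j k.
  by rewrite dfwithin finset.in_set1 => /eqP ->.
by rewrite dfwithout.
Qed.

Lemma product_measure_exists :
  exists mu : probability (vgroup m) R, is_product_measure mu.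
Proof.
exists prm => n A /=; rewrite -/(rect n A).
suff H j : (j <= n)%N -> forall A,
    (forall k, (j <= k < n)%N -> exists v, A k = [set v]%SET) ->
    measurable (rect n A) /\
    prm (rect n A) = (\prod_(k < n) (#|A k|%:R / (m k)%:R))%:E.
  by apply: (proj2 (H n _ A _)) => // k; rewrite ltnNge andbN.
elim: j => [_|j IH jn] {}A As.
  have [x xP] : exists x : vseq m, forall k, (k < n)%N -> A k = [set x k]%SET.
    exists (fun k => xget (0 : 'Z_(m k)) [set v | A k = [set v]%SET]) => k kn.
    exact: (xgetPex (0 : 'Z_(m k)) (As k kn)).
  have -> : rect n A = cylinder n x.
    apply/seteqP; split=> y yP k kn; first by apply/set1P; rewrite -xP// yP.
    by rewrite xP// finset.in_set1 yP.
  split => //; rewrite prm_cyl /M /vbase natr_prod -prodfV; congr EFin.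
  by apply: eq_bigr => k _; rewrite xP// cards1 mul1r.
pose F (v : 'Z_(m j)) : set (vgroup m) :=
  if v \in A j then rect n (dfwith A j [set v]%SET) else set0.
pose c : R := \prod_(k < n | (k : nat) != j) (#|A k|%:R / (m k)%:R).
have FP v : v \in A j -> measurable (F v) /\ prm (F v) = ((m j)%:R^-1 * c)%:E.
  move=> vA; have [k /andP[jk kn]|mF FE] := IH (ltnW jn) (dfwith A j [set v]%SET).
    have [<-|jk'] := eqVneq j k; first by exists v; rewrite dfwithin.
    by rewrite dfwithout//; apply: As; rewrite kn andbT ltn_neqAle jk'.
  rewrite /F vA; split=> //; rewrite FE (bigD1 (Ordinal jn))//= dfwithin cards1.
  rewrite mul1r; congr (_ * _)%:E; apply: eq_bigr => k kj.
  by rewrite dfwithout// eq_sym.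
have mF v : measurable (F v).
  by have [/FP[]//|vA] := boolP (v \in A j); rewrite /F (negbTE vA).
have mU : measurable (\big[setU/set0]_(v : 'Z_(m j)) F v).
  exact: bigsetU_measurable.
rewrite (rectS A jn) -/F; split=> //.
rewrite measure_semi_additive_ord//; last first.
  apply/trivIsetP => u v _ _ uv; apply/seteqP; split=> // x [].
  rewrite /F; case: ifP => // uA /(_ _ jn); rewrite dfwithin finset.in_set1.
  move=> /eqP xu; case: ifP => // vA /(_ _ jn); rewrite dfwithin finset.in_set1.
  by move=> /eqP xv; move: uv; rewrite -xu -xv eqxx.
rewrite (bigID (mem (A j)))/= [X in (_ + X)%E]big1 ?adde0; last first.
  by move=> v vA; rewrite /F (negbTE vA) measure0.
rewrite (eq_bigr (fun=> ((m j)%:R^-1 * c)%:E)); last by move=> v /FP[].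
rewrite sumEFin sumr_const; congr EFin.
by rewrite [RHS](bigD1 (Ordinal jn))//= -/c -[LHS]mulr_natl mulrA.
Qed.

End product_measure_exists.

Definition rademacher (R : realType) (m : nat -> nat) (k : nat) (x : vgroup m)
    : R[i] :=
  let t : R := 2 * pi * (x k : nat)%:R / (m k)%:R in cos t +i* sin t.

(* The factors k >= n are 1 by vdigit_eq0. *)
Definition vilenkin (R : realType) (m : nat -> nat) (n : nat) (x : vgroup m)
    : R[i] :=
  \prod_(k < n) rademacher R k x ^+ vdigit m n k.

Definition Cintegral d (T : measurableType d) (R : realType)
    (mu : {measure set T -> \bar R}) (A : set T) (f : T -> R[i]) : R[i] :=
  (\int[mu]_(x in A) complex.Re (f x))%R +i*
  (\int[mu]_(x in A) complex.Im (f x))%R.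

Definition Cintegrable d (T : measurableType d) (R : realType)
    (mu : {measure set T -> \bar R}) (f : T -> R[i]) : Prop :=
  mu.-integrable [set: T] (EFin \o (fun x => complex.Re (f x))) /\
  mu.-integrable [set: T] (EFin \o (fun x => complex.Im (f x))).

Definition Cmeasurable_for (T : Type) (R : realType) (F : set (set T))
    (f : T -> R[i]) : Prop :=
  forall B : set R, measurable B ->
    F [set x | B (complex.Re (f x))] /\ F [set x | B (complex.Im (f x))].

Definition cabs (T : Type) (R : realType) (f : T -> R[i]) : T -> \bar R :=
  fun x => (Normc.normc (f x))%:E.

(* The last clause says that f n is the conditional expectation of f k given
   the n-th sigma-algebra. *)
Definition is_martingale (R : realType) (m : nat -> nat)
    (mu : probability (vgroup m) R) (f : nat -> vgroup m -> R[i]) : Prop :=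
  [/\ forall n, Cmeasurable_for (vfiltration m n) (f n),
      forall n, Cintegrable mu (f n) &
      forall n k A, (n <= k)%N -> vfiltration m n A ->
        Cintegral mu A (f k) = Cintegral mu A (f n)].

Definition maximal_function (R : realType) (m : nat -> nat)
    (f : nat -> vgroup m -> R[i]) (x : vgroup m) : \bar R :=
  ereal_sup [set cabs (f n) x | n in [set: nat]].

Definition Hnorm (R : realType) (m : nat -> nat)
    (mu : probability (vgroup m) R) (p : R) (f : nat -> vgroup m -> R[i])
    : \bar R :=
  'N[mu]_(p%:E)[maximal_function f]%E.

Definition hardy (R : realType) (m : nat -> nat)
    (mu : probability (vgroup m) R) (p : R) (f : nat -> vgroup m -> R[i])
    : Prop :=
  is_martingale mu f /\ (Hnorm mu p f < +oo)%E.

Definition weakLnorm d (T : measurableType d) (R : realType)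
    (mu : {measure set T -> \bar R}) (p : R) (g : T -> \bar R) : \bar R :=
  (ereal_sup [set (l `^ p)%:E * mu [set x | l%:E < `|g x|] | l in `]0%R, +oo[%classic]
    `^ p^-1)%E.

(* R[i] only gets a topology through its regular alias R[i]^o. *)
Definition vcoef (R : realType) (m : nat -> nat)
    (mu : probability (vgroup m) R) (f : nat -> vgroup m -> R[i]) (i : nat)
    : R[i] :=
  limn (fun k => Cintegral mu [set: vgroup m]
                   (fun x => f k x * (vilenkin R i x)^*) : R[i]^o).

Definition psum (R : realType) (m : nat -> nat)
    (mu : probability (vgroup m) R) (f : nat -> vgroup m -> R[i]) (n : nat)
    (x : vgroup m) : R[i] :=
  \sum_(k < n) vcoef mu f k * vilenkin R k x.

Definition Qsum (R : realType) (q : nat -> R) (n : nat) : R := \sum_(k < n) q k.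

Definition Tmean (R : realType) (m : nat -> nat)
    (mu : probability (vgroup m) R) (q : nat -> R)
    (f : nat -> vgroup m -> R[i]) (n : nat) (x : vgroup m) : R[i] :=
  ((Qsum q n)^-1)%:C * \sum_(k < n) (q k)%:C * psum mu f k x.

Definition Tmaximal (R : realType) (m : nat -> nat)
    (mu : probability (vgroup m) R) (q : nat -> R)
    (f : nat -> vgroup m -> R[i]) (x : vgroup m) : \bar R :=
  ereal_sup [set cabs (Tmean mu q f n) x | n in [set n | (0 < n)%N]].

(* Main.v *)
Require Import Defs.
From HB Require Import structures.
From mathcomp Require Import all_boot all_order all_algebra.
From mathcomp Require Import complex.
From mathcomp Require Import all_classical all_reals all_analysis.
From mathcomp Require Import measurable_realfun.
From mathcomp Require Import ring lra zify.

Set Implicit Arguments.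
Unset Strict Implicit.
Unset Printing Implicit Defensive.

Import Order.TTheory GRing.Theory Num.Theory.
Import numFieldTopology.Exports numFieldNormedType.Exports.

Local Open Scope classical_set_scope.
Local Open Scope ring_scope.

(** Part (a).  The weights [q] being non-increasing, summation by parts writes a
    T mean as a convex combination of Fejer means ([abel_le]), so that it is enough
    to bound the maximal operator of the Fejer means from [H_(1/2)] to weak
    [L_(1/2)].

    The [n]-th partial sums and Fejer means of [f], at a point [x], are averages
    over [t] of [f K t], for [K] large, against kernels that depend on [x] and [t]
    only through the roots of unity [w_k = r_k(x) / r_k(t)].  In mixed radix the
    kernels split into blocks, and two facts carry everything.  If [x] and [t]
    differ first at [k] and next at [l], then whole blocks cancel ([fejer_eq0]) and,
    with [M = vbase m], [n] times the [n]-th Fejer kernel is at most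
    [M (k+1) * M (l+1)], uniformly in [n].  If [x] and [t] are separated by a
    coordinate below [N], then [fejer_block] expresses kernels of large index
    through those of index at most [M N].  The set of [x] with given [t], [k], [l] has measure about [1 / M l], and
    a lacunary summation shows that the resulting majorant is in weak [L_(1/2)],
    in the form [avg_min_majorant_le] of a bound of truncated means.

    Given a height [lam], let [L] be a small multiple of [lam], and stop [f] just
    before it exceeds [L], [2 L], [4 L] and so on.  The martingale stopped at [L] is
    bounded, hence so are its Fejer means, because the [L_1] norms of the Fejer
    kernels are bounded ([avg_fejer_le]).  The difference of two consecutive stopped
    martingales is a sum of atoms: on every cylinder where it starts it has mean
    zero and is at most [3 * 2 ^ i * L].  Outside the set where [f] is stopped at
    [L], whose measure is controlled by the maximal function, an atom has a Fejer
    maximal function dominated by the majorant above ([normc_avg_atom]).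
    Truncated means being subadditive, the contributions of all atoms add up to a
    geometric sum bounded by the average of the square root of the maximal function
    ([weak_type_fejer]).  All this takes place among functions of finitely many
    coordinates, where integrals are finite averages; monotone limits then give the
    statement about the measure.

    Part (b).  The martingale whose increments are [M a ^ 2 * s ^ a] times [r_a] on
    the cylinder of order [a] around a fixed point is in [H_p] when [s > 1] is close
    enough to [1], because [2 p < 1].  Its Fourier coefficient of index [M a] is
    [M a * s ^ a].  Two consecutive T means determine the partial sum between them
    ([psum_le_Tmean]), and the hypothesis on [q] says that the partial sum of index
    [M a + 1] enters with a factor at least [c / M a].  Away from the point this
    partial sum is about [M a * s ^ a], so the T means of index [M a + 1] and
    [M a + 2] cannot both be small there. *)

(** * Averages over finitely many coordinates *)

Definition agree m N (x y : vseq m) := forall k, (k < N)%N -> x k = y k.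

Definition depends_below m (T : Type) N (h : vseq m -> T) :=
  forall x y, agree N x y -> h x = h y.

Definition coord_avg (F : numFieldType) m j (h : vseq m -> F) (x : vseq m) : F :=
  (m j)%:R^-1 * \sum_(d : 'Z_(m j)) h (dfwith x j d).

(** One representative for each of the cylinders of order [K]. *)
Fixpoint reps m K : seq (vseq m) :=
  if K is j.+1 then [seq dfwith x j d | x <- reps m j, d <- index_enum 'Z_(m j)]
  else [:: fun=> 0].

(** The integral of a function of the first [K] coordinates. *)
Definition avg (F : numFieldType) m K (h : vseq m -> F) : F :=
  (vbase m K)%:R^-1 * \sum_(x <- reps m K) h x.

Section averages.
Variables (m : nat -> nat) (m2 : forall k, (2 <= m k)%N).
Variable F : numFieldType.
Implicit Types (h g : vseq m -> F) (x y : vseq m).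

Lemma vbaseS k : vbase m k.+1 = (vbase m k * m k)%N.
Proof. by rewrite /vbase big_ord_recr. Qed.

Lemma vbase0 : vbase m 0 = 1%N.
Proof. by rewrite /vbase big_ord0. Qed.

Lemma card_Zm j : #|'Z_(m j)| = m j.
Proof. by rewrite card_ord Zp_cast. Qed.

Lemma m_neq0 j : (m j)%:R != 0 :> F.
Proof. by rewrite pnatr_eq0 -lt0n ltnW. Qed.

Lemma vbase_neq0 K : (vbase m K)%:R != 0 :> F.
Proof. by rewrite pnatr_eq0 -lt0n vbase_gt0. Qed.

Lemma agree_sym N x y : agree N x y -> agree N y x.
Proof. by move=> xy k kN; rewrite xy. Qed.

Lemma agree_trans N x y z : agree N x y -> agree N y z -> agree N x z.
Proof. by move=> xy yz k kN; rewrite xy ?yz. Qed.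

Lemma agree_leq N N' x y : (N <= N')%N -> agree N' x y -> agree N x y.
Proof. by move=> NN xy k kN; rewrite xy// (leq_trans kN). Qed.

Lemma agree_dfwith N x j (d : 'Z_(m j)) : (N <= j)%N -> agree N (dfwith x j d) x.
Proof. by move=> Nj k kN; rewrite dfwithout// gtn_eqF// (leq_trans kN). Qed.

Lemma depends_leq T N N' (h : vseq m -> T) :
  (N <= N')%N -> depends_below N h -> depends_below N' h.
Proof. by move=> NN hN x y /(agree_leq NN); exact: hN. Qed.

Lemma eq_coord_avg h g j x : (forall y, h y = g y) ->
  coord_avg j h x = coord_avg j g x.
Proof. by move=> hg; congr (_ * _); apply: eq_bigr. Qed.

Lemma coord_avgD h g j x :
  coord_avg j (fun y => h y + g y) x = coord_avg j h x + coord_avg j g x.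
Proof. by rewrite /coord_avg big_split mulrDr. Qed.

Lemma coord_avg_dependsS h n : depends_below n.+1 h ->
  depends_below n (coord_avg n h).
Proof.
move=> hn x y xy; congr (_ * _); apply: eq_bigr => d _; apply: hn => k.
rewrite ltnS leq_eqVlt => /predU1P[->|kn]; first by rewrite !dfwithin.
by rewrite !dfwithout ?gtn_eqF// xy.
Qed.

Lemma coord_avgM h g j x : (forall y d, h (dfwith y j d) = h y) ->
  coord_avg j (fun y => h y * g y) x = h x * coord_avg j g x.
Proof.
move=> hj; rewrite /coord_avg mulrCA; congr (_ * _).
by rewrite mulr_sumr; apply: eq_bigr => d _; rewrite hj.
Qed.

Lemma coord_avg_cst (c : F) j x : coord_avg j (fun _ : vseq m => c) x = c.
Proof.
rewrite /coord_avg sumr_const card_Zm -[c *+ _]mulr_natl mulKf//.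
exact: m_neq0.
Qed.

Lemma coord_avg_id h j x : (forall y d, h (dfwith y j d) = h y) ->
  coord_avg j h x = h x.
Proof.
move=> hj; rewrite -(coord_avg_cst (h x) j x); congr (_ * _).
by apply: eq_bigr => d _; rewrite hj.
Qed.

Lemma depends_dfwith T N (h : vseq m -> T) j y (d : 'Z_(m j)) : depends_below N h -> (N <= j)%N ->
  h (dfwith y j d) = h y.
Proof. by move=> hN Nj; apply: hN; apply: agree_dfwith. Qed.

Lemma dfwith_idem x j (c d : 'Z_(m j)) : dfwith (dfwith x j c) j d = dfwith x j d.
Proof.
apply: functional_extensionality_dep => k.
by have [<-|jk] := eqVneq j k; rewrite ?dfwithin// !dfwithout.
Qed.

Lemma dfwith_comm x i j (c : 'Z_(m i)) (d : 'Z_(m j)) : i != j ->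
  dfwith (dfwith x i c) j d = dfwith (dfwith x j d) i c.
Proof.
move=> ij; apply: functional_extensionality_dep => k.
have [jk|jk] := eqVneq j k.
  by rewrite -jk dfwithin dfwithout// dfwithin.
rewrite dfwithout//; have [ik|ik] := eqVneq i k.
  by rewrite -ik !dfwithin.
by rewrite !dfwithout.
Qed.

Lemma coord_avg_idem h j x : coord_avg j (coord_avg j h) x = coord_avg j h x.
Proof.
apply: coord_avg_id => y d; congr (_ * _).
by apply: eq_bigr => c _; rewrite dfwith_idem.
Qed.

Lemma coord_avg_comm h i j x : i != j ->
  coord_avg i (coord_avg j h) x = coord_avg j (coord_avg i h) x.
Proof.
move=> ij; rewrite /coord_avg -!mulr_sumr mulrCA; congr (_ * (_ * _)).
rewrite exchange_big/=; apply: eq_bigr => d _; apply: eq_bigr => c _.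
by rewrite dfwith_comm.
Qed.

Lemma avg0 h : avg 0 h = h (fun=> 0).
Proof. by rewrite /avg vbase0 invr1 mul1r big_seq1. Qed.

Lemma avgS K h : avg K.+1 h = avg K (coord_avg K h).
Proof.
rewrite /avg [reps m K.+1]/= big_allpairs_dep/= vbaseS natrM invfM -mulrA.
by congr (_ * _); rewrite mulr_sumr.
Qed.

Lemma eq_avg K h g : (forall x, h x = g x) -> avg K h = avg K g.
Proof. by move=> hg; congr (_ * _); apply: eq_bigr. Qed.

Lemma avg_coord_avg K j h : (j < K)%N -> avg K (coord_avg j h) = avg K h.
Proof.
elim: K h => // K IH h; rewrite ltnS leq_eqVlt => /predU1P[->|jK].
  by rewrite !avgS; apply: eq_avg => x; exact: coord_avg_idem.
rewrite !avgS -[RHS]IH//; apply: eq_avg => x; apply: coord_avg_comm.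
by rewrite gtn_eqF.
Qed.

Lemma avg_depends N K h : depends_below N h -> (N <= K)%N -> avg K h = avg N h.
Proof.
move=> hN; elim: K => [|K IH]; first by rewrite leqn0 => /eqP ->.
rewrite leq_eqVlt => /predU1P[->//|NK]; rewrite -IH// avgS; apply: eq_avg => x.
by apply: coord_avg_id => y d; rewrite (depends_dfwith _ _ hN).
Qed.

Lemma avgD K h g : avg K (fun x => h x + g x) = avg K h + avg K g.
Proof. by rewrite /avg big_split/= mulrDr. Qed.

Lemma avgN K h : avg K (fun x => - h x) = - avg K h.
Proof. by rewrite /avg sumrN mulrN. Qed.

Lemma avgB K h g : avg K (fun x => h x - g x) = avg K h - avg K g.
Proof. by rewrite avgD avgN. Qed.

Lemma avgZ K c h : avg K (fun x => c * h x) = c * avg K h.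
Proof. by rewrite /avg -mulr_sumr mulrCA. Qed.

Lemma avg_sum (I : Type) (r : seq I) (P : pred I) (f : I -> vseq m -> F) K :
  avg K (fun x => \sum_(i <- r | P i) f i x) = \sum_(i <- r | P i) avg K (f i).
Proof. by rewrite /avg exchange_big/= mulr_sumr. Qed.

Lemma avg_cst K (c : F) : avg K (fun _ : vseq m => c) = c.
Proof.
elim: K => [|K IH]; first by rewrite avg0.
by rewrite avgS -[RHS]IH; apply: eq_avg => x; exact: coord_avg_cst.
Qed.

Lemma le_avg K h g : (forall x, h x <= g x) -> avg K h <= avg K g.
Proof.
by move=> hg; rewrite ler_wpM2l ?invr_ge0// ler_sum.
Qed.

Lemma avg_ge0 K h : (forall x, 0 <= h x) -> 0 <= avg K h.
Proof. by move=> h0; rewrite -(avg_cst K 0); exact: le_avg. Qed.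

(** Each constrained coordinate [j] contributes a factor [1 / m j].  For [k >= l] no
    coordinate below [l] is free, and this is the measure of a cylinder. *)
Lemma avg_agree_but K l k y : (l <= K)%N ->
  avg K (fun x : vseq m => (`[< forall j, (j < l)%N -> j != k -> x j = y j >])%:R : F) =
  (vbase m l)%:R^-1 * (if (k < l)%N then (m k)%:R else 1).
Proof.
move=> lK; rewrite (@avg_depends l)//; last first.
  move=> x z xz; congr ((nat_of_bool _)%:R); apply/asboolP/asboolP => H j jl jk.
    by rewrite -xz// H.
  by rewrite xz// H.
elim: l {lK} => [|l IH].
  by rewrite avg0 vbase0 invr1 mul1r; case: asboolP => // -[].
rewrite avgS vbaseS natrM invfM.
pose c : F := if l == k then 1 else (m l)%:R^-1.
transitivity (avg l (fun x => (c : F) *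
    (`[< forall j, (j < l)%N -> j != k -> x j = y j >])%:R)).
  apply: eq_avg => x; rewrite /coord_avg.
  have E (d : 'Z_(m l)) :
      `[< forall j, (j < l.+1)%N -> j != k -> dfwith x l d j = y j >] =
      `[< forall j, (j < l)%N -> j != k -> x j = y j >] && ((l == k) || (d == y l)).
    apply/asboolP/idP => [H|/andP[/asboolP H1 H2] j].
      apply/andP; split.
        apply/asboolP => j jl jk.
        by have := H j (ltnW jl) jk; rewrite dfwithout// gtn_eqF.
      have [//|lk] := eqVneq l k.
      by have := H l (ltnSn l) lk; rewrite dfwithin => ->; rewrite eqxx.
    rewrite ltnS leq_eqVlt => /predU1P[->|jl] jk.
      by move: H2; rewrite (negbTE jk) => /eqP ->; rewrite dfwithin.
    by rewrite dfwithout ?gtn_eqF// H1.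
  under eq_bigr do rewrite E -mulnb natrM.
  rewrite -mulr_sumr mulrCA mulrC; congr (_ * _).
  rewrite /c; case: eqVneq => lk /=.
    by rewrite sumr_const card_Zm mulVf ?m_neq0.
  by rewrite (bigD1 (y l))//= eqxx big1 ?addr0 ?mulr1// => d /negbTE ->.
rewrite avgZ IH /c [(k < l.+1)%N]ltnS [(k <= l)%N]leq_eqVlt eq_sym; have [->|lk] := eqVneq k l.
  by rewrite ltnn mul1r/= mulr1 -mulrA mulVf ?m_neq0// mulr1.
by case: (k < l)%N; rewrite /= mulrA [_^-1 * _^-1]mulrC.
Qed.

Lemma avg_agree K N y : (N <= K)%N ->
  avg K (fun x : vseq m => (`[< agree N x y >])%:R : F) = (vbase m N)%:R^-1.
Proof.
move=> NK; have := avg_agree_but N y NK; rewrite ltnn mulr1 => <-.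
apply: eq_avg => x; congr ((nat_of_bool _)%:R).
apply/asboolP/asboolP => H j jN; first by move=> _; apply: H.
by apply: H => //; rewrite ltn_eqF.
Qed.

(** The sum has a single nonzero term, as every cylinder of order [N] has exactly one
    representative. *)
Lemma sum_reps_agree N h y : depends_below N h ->
  \sum_(x <- reps m N) h x * (`[< agree N x y >])%:R = h y.
Proof.
move=> hN; transitivity (h y * \sum_(x <- reps m N) (`[< agree N x y >])%:R).
  rewrite mulr_sumr; apply: eq_bigr => x _; case: asboolP => [/hN ->//|_].
  by rewrite !mulr0.
rewrite -[X in _ * X](mulVKf (vbase_neq0 N)) -/(avg N _) avg_agree//.
by rewrite divff ?vbase_neq0// mulr1.
Qed.

End averages.

(** * Dirichlet and Fejer kernels *)

(** For [w k = r_k(x) / r_k(t)] this is [psi_n(x) / psi_n(t)]: the two points enter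
    the kernels only through these roots of unity. *)
Definition vchar (C : numFieldType) (m : nat -> nat) (w : nat -> C) n : C :=
  \prod_(k < n) w k ^+ vdigit m n k.

Definition dirichlet (C : numFieldType) (m : nat -> nat) (w : nat -> C) n : C :=
  \sum_(k < n) vchar m w k.

(** This is [n] times the [n]-th Fejer kernel. *)
Definition fejer (C : numFieldType) (m : nat -> nat) (w : nat -> C) n : C :=
  \sum_(k < n) dirichlet m w k.

Section kernels.
Variables (m : nat -> nat) (m2 : forall k, (2 <= m k)%N).
Variables (C : numFieldType) (w : nat -> C) (hw : forall k, w k ^+ m k = 1).

Local Notation M := (vbase m).
Local Notation chi := (vchar m w).
Local Notation D := (dirichlet m w).
Local Notation FF := (fejer m w).

Lemma vbaseD k j : M (k + j) = (M k * \prod_(i < j) m (k + i))%N.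
Proof.
elim: j => [|j IH]; first by rewrite addn0 big_ord0 muln1.
by rewrite addnS vbaseS IH big_ord_recr/= mulnA.
Qed.

Lemma leq_vbase k l : (k <= l)%N -> (M k <= M l)%N.
Proof.
move=> kl; rewrite -(subnKC kl) vbaseD leq_pmulr// prodn_gt0// => i.
exact: ltnW.
Qed.

Lemma vdigit_small n k K : (n < M K)%N -> (K <= k)%N -> vdigit m n k = 0%N.
Proof.
move=> nK Kk; rewrite /vdigit divn_small ?mod0n//.
by rewrite (leq_trans nK)// leq_vbase.
Qed.

Lemma vcharE n K : (n < M K)%N -> chi n = \prod_(k < K) w k ^+ vdigit m n k.
Proof.
move=> nK; rewrite /vchar.
transitivity (\prod_(0 <= k < maxn n K) w k ^+ vdigit m n k).
  rewrite (@big_cat_nat _ _ _ n)//= ?leq_maxl// big_mkord.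
  rewrite [X in _ * X]big_nat_cond [X in _ * X]big1 ?mulr1// => k.
  by rewrite andbT => /andP[nk _]; rewrite vdigit_eq0.
rewrite (@big_cat_nat _ _ _ K)//= ?leq_maxr// big_mkord.
rewrite [X in _ * X]big_nat_cond [X in _ * X]big1 ?mulr1// => k.
by rewrite andbT => /andP[Kk _]; rewrite (@vdigit_small _ _ K).
Qed.

Lemma vdigit_mul N s k : (k < N)%N -> vdigit m (s * M N) k = 0%N.
Proof.
move=> kN; rewrite /vdigit -(subnKC kN) vbaseD vbaseS; set e := (\prod_(_ < _) _)%N.
rewrite (_ : s * (M k * m k * e) = s * e * m k * M k)%N; last by lia.
by rewrite mulnK ?vbase_gt0// modnMl.
Qed.

Lemma vdigit_block N s r k : (r < M N)%N ->
  vdigit m (s * M N + r) k = (vdigit m (s * M N) k + vdigit m r k)%N.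
Proof.
move=> rN; have [kN|Nk] := ltnP k N.
  rewrite vdigit_mul// add0n /vdigit -(subnKC kN) vbaseD vbaseS.
  set e := (\prod_(_ < _) _)%N.
  rewrite (_ : s * (M k * m k * e) = s * e * m k * M k)%N; last by lia.
  by rewrite divnMDl ?vbase_gt0// modnMDl.
rewrite (vdigit_small rN Nk) addn0 /vdigit -(subnKC Nk) vbaseD.
by rewrite !divnMA divnMDl ?vbase_gt0// (divn_small rN) addn0 mulnK ?vbase_gt0.
Qed.

Lemma vchar_block N s r : (r < M N)%N ->
  chi (s * M N + r) = chi (s * M N) * chi r.
Proof.
move=> rN; set K := (s * M N + r)%N.
have KK : (K < M K)%N by exact: vbase_gt.
rewrite (vcharE KK) (@vcharE (s * M N) K); last first.
  by rewrite (leq_ltn_trans _ KK)// leq_addr.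
rewrite (@vcharE r K) ?(leq_ltn_trans _ KK) ?leq_addl//.
by rewrite -big_split/=; apply: eq_bigr => k _; rewrite vdigit_block// exprD.
Qed.

Lemma vchar_pow N s : (s < m N)%N -> chi (s * M N) = w N ^+ s.
Proof.
move=> sN; have sMN : (s * M N < M N.+1)%N.
  by rewrite vbaseS mulnC ltn_pmul2l// vbase_gt0.
rewrite (vcharE sMN) big_ord_recr/= big1 ?mul1r => [|k _]; last first.
  by rewrite vdigit_mul.
by rewrite /vdigit mulnK ?vbase_gt0// modn_small.
Qed.

Lemma norm_w k : `|w k| = 1.
Proof.
apply/eqP; rewrite -(@pexpr_eq1 _ _ (m k)) ?(ltnW (m2 k))//.
by rewrite -normrX hw normr1.
Qed.

Lemma norm_vchar n : `|chi n| = 1.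
Proof.
by rewrite /vchar normr_prod big1// => k _; rewrite normrX norm_w expr1n.
Qed.

Lemma dirichletS n : D n.+1 = D n + chi n.
Proof. by rewrite /dirichlet big_ord_recr. Qed.

Lemma fejerS n : FF n.+1 = FF n + D n.
Proof. by rewrite /fejer big_ord_recr. Qed.

Lemma dirichlet0 : D 0 = 0. Proof. by rewrite /dirichlet big_ord0. Qed.

Lemma fejer0 : FF 0 = 0. Proof. by rewrite /fejer big_ord0. Qed.

Lemma dirichlet_block N s r : (r <= M N)%N ->
  D (s * M N + r) = D (s * M N) + chi (s * M N) * D r.
Proof.
elim: r => [|r IH] rN; first by rewrite addn0 dirichlet0 mulr0 addr0.
by rewrite addnS !dirichletS IH ?(ltnW rN)// vchar_block// mulrDr addrA.
Qed.

Lemma dirichlet_mul N s : D (s * M N) = (\sum_(i < s) chi (i * M N)) * D (M N).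
Proof.
elim: s => [|s IH]; first by rewrite mul0n dirichlet0 big_ord0 mul0r.
by rewrite mulSn addnC dirichlet_block// IH big_ord_recr/= mulrDl.
Qed.

Lemma sum_vchar_pow N : \sum_(i < m N) chi (i * M N) = \sum_(i < m N) w N ^+ i.
Proof. by apply: eq_bigr => i _; rewrite vchar_pow. Qed.

Lemma sum_pow_eq0 k : w k != 1 -> \sum_(i < m k) w k ^+ i = 0.
Proof.
move=> wk; apply/eqP; have := subrX1 (w k) (m k).
by rewrite hw subrr => /esym/eqP; rewrite mulf_eq0 subr_eq0 (negbTE wk).
Qed.

Lemma dirichlet_vbaseS N : D (M N.+1) = (\sum_(i < m N) w N ^+ i) * D (M N).
Proof. by rewrite vbaseS mulnC dirichlet_mul sum_vchar_pow. Qed.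

Lemma dirichlet_eq0 N k : (k < N)%N -> w k != 1 -> D (M N) = 0.
Proof.
move=> kN wk; elim: N kN => // N IH; rewrite ltnS leq_eqVlt dirichlet_vbaseS.
by move=> /predU1P[<-|/IH ->]; [rewrite sum_pow_eq0// mul0r|rewrite mulr0].
Qed.

Lemma dirichlet_vbase N : (forall k, (k < N)%N -> w k = 1) -> D (M N) = (M N)%:R.
Proof.
elim: N => [|N IH] w1.
  by rewrite vbase0 /dirichlet big_ord1 /vchar big_ord0.
rewrite dirichlet_vbaseS IH => [|k kN]; last by rewrite w1// ltnW.
rewrite w1// vbaseS natrM mulrC; congr (_ * _).
by under eq_bigr do rewrite expr1n; rewrite sumr_const card_ord.
Qed.

Lemma dirichlet_differ N k s r : (k < N)%N -> w k != 1 -> (r <= M N)%N ->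
  D (s * M N + r) = chi (s * M N) * D r.
Proof.
move=> kN wk rN.
by rewrite dirichlet_block// dirichlet_mul (dirichlet_eq0 kN wk) mulr0 add0r.
Qed.

Lemma fejer_block N k s r : (k < N)%N -> w k != 1 -> (r <= M N)%N ->
  FF (s * M N + r) =
  (\sum_(i < s) chi (i * M N)) * FF (M N) + chi (s * M N) * FF r.
Proof.
move=> kN wk; have step s' r' : (r' <= M N)%N ->
    FF (s' * M N + r') = FF (s' * M N) + chi (s' * M N) * FF r'.
  elim: r' => [|r' IH] rN; first by rewrite addn0 fejer0 mulr0 addr0.
  rewrite addnS !fejerS IH ?(ltnW rN)// (dirichlet_differ _ kN)//.
    by rewrite mulrDr addrA.
  exact: ltnW.
move=> rN; rewrite step//; congr (_ + _); elim: s => [|s IH].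
  by rewrite mul0n fejer0 big_ord0 mul0r.
by rewrite mulSn addnC step// IH big_ord_recr/= mulrDl.
Qed.

(** By [fejer_block] the sum of the powers of [w l] factors out, and it vanishes.  The
    resulting decay in the second difference [l] is what yields the exponent
    [1 / 2]. *)
Lemma fejer_eq0 k l : (k < l)%N -> w k != 1 -> w l != 1 -> FF (M l.+1) = 0.
Proof.
move=> kl wk wl; rewrite vbaseS mulnC -[X in FF X]addn0.
rewrite (fejer_block _ kl)// fejer0 mulr0 addr0 sum_vchar_pow sum_pow_eq0//.
by rewrite mul0r.
Qed.

Lemma norm_dirichlet n : `|D n| <= n%:R.
Proof.
apply: le_trans (ler_norm_sum _ _ _) _.
under eq_bigr do rewrite norm_vchar.
by rewrite sumr_const card_ord.
Qed.

Lemma norm_dirichlet_differ k n : w k != 1 -> `|D n| <= (M k.+1)%:R.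
Proof.
move=> wk; have M0 : (0 < M k.+1)%N by exact: vbase_gt0.
rewrite (divn_eq n (M k.+1)) (dirichlet_differ _ (ltnSn k))//.
  rewrite normrM norm_vchar mul1r (le_trans (norm_dirichlet _))// ler_nat.
  by rewrite ltnW// ltn_mod.
by rewrite ltnW// ltn_mod.
Qed.

Lemma norm_fejer n : `|FF n| <= (n ^ 2)%:R.
Proof.
apply: le_trans (ler_norm_sum _ _ _) _.
apply: (@le_trans _ _ (\sum_(k < n) n%:R)).
  apply: ler_sum => k _; apply: le_trans (norm_dirichlet _) _.
  by rewrite ler_nat ltnW.
by rewrite sumr_const card_ord natrX expr2 mulr_natr.
Qed.

Lemma norm_fejer_differ k n : w k != 1 -> `|FF n| <= (n * M k.+1)%:R.
Proof.
move=> wk; apply: le_trans (ler_norm_sum _ _ _) _.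
apply: (@le_trans _ _ (\sum_(k' < n) (M k.+1)%:R)).
  by apply: ler_sum => k' _; apply: norm_dirichlet_differ.
by rewrite sumr_const card_ord mulnC natrM mulr_natr.
Qed.

Lemma norm_fejer_differ2 k l n : (k < l)%N -> w k != 1 -> w l != 1 ->
  `|FF n| <= (M k.+1 * M l.+1)%:R.
Proof.
move=> kl wk wl; have M0 : (0 < M l.+1)%N by exact: vbase_gt0.
have kl1 : (k < l.+1)%N by rewrite ltnW.
rewrite (divn_eq n (M l.+1)) (fejer_block _ kl1)//; last by rewrite ltnW// ltn_mod.
rewrite (fejer_eq0 kl)// mulr0 add0r normrM norm_vchar mul1r.
apply: le_trans (norm_fejer_differ _ wk) _.
by rewrite ler_nat mulnC leq_mul2l (ltnW (ltn_pmod _ M0)) orbT.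
Qed.

(** Both terms of [fejer_block] are controlled by Fejer kernels of index at most
    [M N]. *)
Lemma norm_fejer_block N k s r (B : C) : (k < N)%N -> w k != 1 -> (r <= M N)%N ->
  `|FF (M N)| <= B -> `|FF r| <= B -> `|FF (s * M N + r)| <= s.+1%:R * B.
Proof.
move=> kN wk rN FN Fr; rewrite (fejer_block _ kN wk rN).
rewrite (le_trans (ler_normD _ _))// -natr1 mulrDl mul1r lerD//; last first.
  by rewrite normrM norm_vchar mul1r.
rewrite normrM ler_pM// (le_trans (ler_norm_sum _ _ _))//.
under eq_bigr do rewrite norm_vchar.
by rewrite sumr_const card_ord.
Qed.

End kernels.

(** * Lacunary sums *)

Lemma min_subadd (R : realDomainType) (c a b : R) : 0 <= a -> 0 <= b -> 0 <= c ->
  Num.min (a + b) c <= Num.min a c + Num.min b c.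
Proof.
by move=> a0 b0 c0; rewrite !minEle; do 3?case: ifPn; rewrite -?ltNge; lra.
Qed.

Lemma min_sum_le (R : realDomainType) (I : Type) (r : seq I) (P : pred I)
    (u : I -> R) c : 0 <= c -> (forall i, P i -> 0 <= u i) ->
  Num.min (\sum_(i <- r | P i) u i) c <= \sum_(i <- r | P i) Num.min (u i) c.
Proof.
move=> c0 u0; elim: r => [|i r IH]; first by rewrite !big_nil min_l.
rewrite !big_cons; case: ifP => // Pi.
apply: (le_trans (min_subadd _ _ _)) => //; first exact: u0.
  exact: sumr_ge0.
by rewrite lerD2l.
Qed.

Lemma sum_doubling (R : realFieldType) (a : nat -> R) n :
  (forall k, 0 <= a k) -> (forall k, 2 * a k <= a k.+1) ->
  \sum_(k < n.+1) a k <= 2 * a n.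
Proof.
move=> a0 a2; elim: n => [|n IH]; first by rewrite big_ord1; have := a0 0%N; lra.
by rewrite big_ord_recr/=; have := a2 n; lra.
Qed.

Lemma sum_min_inv (R : realFieldType) (b : nat -> R) n :
  (forall k, 0 < b k) -> (forall k, 2 * b k <= b k.+1) ->
  \sum_(k < n) Num.min (b k) (b k)^-1 <= 4.
Proof.
move=> b0 b2.
have b0' k : 0 <= b k by exact: ltW.
(* While [b k <= 1] the sum is geometric.  Afterwards the slack [(b k)^-1] pays for
   all the terms to come. *)
suff H k : \sum_(j < k.+1) Num.min (b j) (b j)^-1 <=
    if b k <= 1 then 2 * b k else 4 - (b k)^-1.
  case: n => [|k]; first by rewrite big_ord0.
  apply: le_trans (H k) _; have := b0 k; rewrite -invr_gt0.
  by case: ifP; lra.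
elim: k => [|k IH].
  rewrite big_ord1; case: ifPn => b01.
    by rewrite ge_min; apply/orP; left; have := b0 0%N; lra.
  rewrite ge_min; apply/orP; right; rewrite -ltNge in b01.
  by have := invf_lt1 (b0 0%N); rewrite b01 => i1; lra.
rewrite big_ord_recr/=; have bk := b2 k; have bk0 := b0 k; have bk1 := b0 k.+1.
case: ifPn => h.
  have h' : b k <= 1 by lra.
  rewrite h' in IH; apply: (le_trans (lerD IH (_ : _ <= b k.+1))).
    by rewrite ge_min lexx.
  lra.
rewrite -ltNge in h; have i1 : (b k.+1)^-1 < 1 by rewrite invf_lt1.
apply: (le_trans (lerD IH (_ : _ <= (b k.+1)^-1))).
  by rewrite ge_min lexx orbT.
case: ifP => h'; first by lra.
have : (b k.+1)^-1 <= (2 * b k)^-1 by rewrite lef_pV2// ?posrE ?mulr_gt0.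
by rewrite invfM; lra.
Qed.

Lemma sum_geometric_le (R : realFieldType) (r : R) n : 0 <= r -> r < 1 ->
  \sum_(i < n) r ^+ i <= (1 - r)^-1.
Proof.
move=> r0 r1; rewrite -[leRHS]mul1r ler_pdivlMr ?subr_gt0//.
have E := subrX1 r n.
have : 0 <= r ^+ n by exact: exprn_ge0.
by lra.
Qed.

Definition lacunary_cst (R : rcfType) : R := 4 * (1 - (Num.sqrt 2)^-1)^-1.

Lemma sqrt2_gt1 (R : rcfType) : 1 < Num.sqrt 2 :> R.
Proof. by rewrite -[ltLHS]sqrtr1 ltr_sqrt// ltr1n. Qed.

(** On each diagonal [l = k + d + 1] the double sum is at most [sqrt 2 ^- d] times a
    sum as in [sum_min_inv], since [a k] is at most [2 ^- d * a l]. *)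
Lemma sum_min_lacunary (R : rcfType) (a : nat -> R) n :
  (forall k, 0 < a k) -> (forall k, 2 * a k <= a k.+1) ->
  \sum_(l < n) \sum_(k < l) Num.min (a k) (a l)^-1 <= lacunary_cst R.
Proof.
move=> a0 a2; set r : R := Num.sqrt 2.
have r1 : 1 < r by exact: sqrt2_gt1.
have r0 : 0 < r by lra.
have r2 : r ^+ 2 = 2 by rewrite sqr_sqrtr.
have growth k d : 2 ^+ d * a k <= a (k + d)%N.
  elim: d => [|d IH]; first by rewrite addn0 mul1r.
  rewrite addnS (le_trans _ (a2 _))// exprS -mulrA; lra.
pose G l d : R := r^-1 ^+ d * Num.min (r^-1 ^+ d * a l) (r^-1 ^+ d * a l)^-1.
have G0 l d : 0 <= G l d.
  have q0 : 0 <= r^-1 ^+ d by rewrite exprn_ge0// invr_ge0 ltW.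
  have p0 : 0 <= r^-1 ^+ d * a l by rewrite mulr_ge0// ltW.
  by rewrite mulr_ge0// le_min p0 invr_ge0.
apply: (@le_trans _ _ (\sum_(l < n) \sum_(d < n) G l d)).
  apply: ler_sum => l _.
  apply: (@le_trans _ _ (\sum_(d < l) G l d)); last first.
    rewrite [leRHS](bigID (fun d : 'I_n => (d < l)%N))/=.
    rewrite -[leLHS]addr0 lerD ?sumr_ge0//.
    by rewrite (big_ord_widen _ (fun d => G l d) (ltnW (ltn_ord l))).
  rewrite (reindex_inj rev_ord_inj)/=; apply: ler_sum => d _.
  set k := (l - d.+1)%N.
  have lE : (k + d.+1)%N = l by rewrite subnK.
  have qE : r^-1 ^+ d * r^-1 ^+ d = 2^-1 ^+ d.
    by rewrite -exprMn -invfM -expr2 r2.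
  have ak : a k <= 2^-1 ^+ d * a l.
    rewrite exprVn ler_pdivlMl ?exprn_gt0//.
    have := growth k d.+1; rewrite lE; apply: le_trans; rewrite ler_pM2r// exprS ler_peMl ?exprn_ge0//.
    by rewrite ler1n.
  rewrite /G minr_pMr; last by rewrite exprn_ge0// invr_ge0 ltW.
  rewrite mulrA qE invfM mulrA divff ?mul1r; last first.
    by rewrite expf_neq0// invr_eq0 gt_eqF.
  by rewrite le_min !ge_min ak lexx orbT.
rewrite exchange_big/=.
apply: (@le_trans _ _ (\sum_(d < n) r^-1 ^+ d * 4)).
  apply: ler_sum => d _; rewrite -mulr_sumr ler_wpM2l//.
    by rewrite exprn_ge0// invr_ge0 ltW.
  apply: (@sum_min_inv _ (fun l => r^-1 ^+ d * a l)) => k.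
    by rewrite mulr_gt0// exprn_gt0// invr_gt0.
  by rewrite mulrCA ler_pM2l// exprn_gt0// invr_gt0.
rewrite -mulr_suml /lacunary_cst mulrC ler_wpM2l//; apply: sum_geometric_le.
  by rewrite invr_ge0 ltW.
by rewrite invf_lt1.
Qed.

(** * A majorant of the Fejer kernels *)

Section majorant.
Variables (R : realType) (m : nat -> nat) (m2 : forall k, (2 <= m k)%N).
Variables (B : nat) (mB : forall k, (m k <= B)%N).

Local Notation M := (vbase m).

Definition agree_but (x t : vseq m) k l : bool :=
  `[< forall j, (j < l)%N -> j != k -> x j = t j >].

(** If [x] and [t] differ first at [k] and next at [l], or nowhere else below
    [l = N], then the summand at [(k, l)] alone bounds the kernels of index at most
    [M N].  Summing over all [k < l <= N] instead of picking the first differences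
    makes the averages below easy to compute. *)
Definition majorant N (x t : vseq m) : R :=
  \sum_(l < N.+1) \sum_(k < l) (agree_but x t k l)%:R * (M k.+1 * M l.+1)%:R.

Lemma agree_butC x t k l : agree_but x t k l = agree_but t x k l.
Proof. by apply/asboolP/asboolP => H j jl jk; rewrite H. Qed.

Lemma majorantC N x t : majorant N x t = majorant N t x.
Proof.
by apply: eq_bigr => l _; apply: eq_bigr => k _; rewrite agree_butC.
Qed.

Lemma majorant_ge0 N x t : 0 <= majorant N x t.
Proof. by apply: sumr_ge0 => l _; apply: sumr_ge0 => k _. Qed.

Lemma agree_but_depends t k l N : (l <= N)%N ->
  depends_below N (fun x => agree_but x t k l).
Proof.
move=> lN x y xy; apply/asboolP/asboolP => H j jl jk.
  by rewrite -xy ?H// (leq_trans jl).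
by rewrite xy ?H// (leq_trans jl).
Qed.

Lemma majorant_depends t N : depends_below N (fun x => majorant N x t).
Proof.
move=> x y xy; apply: eq_bigr => l _; apply: eq_bigr => k _.
by rewrite (@agree_but_depends t k l N _ x y)// -ltnS.
Qed.

Lemma le_majorant N x t k l : (k < l)%N -> (l <= N)%N -> agree_but x t k l ->
  (M k.+1 * M l.+1)%:R <= majorant N x t.
Proof.
move=> kl lN xt; have lN1 : (l < N.+1)%N by [].
rewrite /majorant (bigD1 (Ordinal lN1))//= (bigD1 (Ordinal kl))//= xt mul1r.
rewrite -addrA lerDl addr_ge0//; first by apply: sumr_ge0.
by apply: sumr_ge0 => i _; apply: sumr_ge0.
Qed.

(** Here [k] is the first difference and [l] the second one, or [N] if there is no
    second one below [N]. *)
Lemma differ_cases N (x t : vseq m) : ~ agree N x t ->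
  exists k l, [/\ (k < l)%N, (l <= N)%N, x k <> t k, agree_but x t k l &
    l = N \/ x l <> t l].
Proof.
move=> /existsNP[k0 /not_implyP[k0N k0d]].
have ex : exists k, `[< x k <> t k >] by exists k0; apply/asboolP.
case: (ex_minnP ex) => k /asboolP kd kmin.
have kN : (k < N)%N by rewrite (leq_ltn_trans (kmin k0 _))//; apply/asboolP.
have [[l0 [kl0 l0N l0d]]|nol] := pselect (exists l, [/\ (k < l)%N, (l < N)%N & x l <> t l]).
  have ex' : exists l, `[< [/\ (k < l)%N, (l < N)%N & x l <> t l] >].
    by exists l0; apply/asboolP.
  case: (ex_minnP ex') => l /asboolP[kl lN ld] lmin.
  exists k, l; split; [by []|exact: ltnW|by []| |by right].
  apply/asboolP => j jl jk; apply: contrapT => jd.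
  have [kj|jk'] := ltnP k j.
    have : (l <= j)%N by apply: lmin; apply/asboolP; split=> //; apply: ltn_trans lN.
    by rewrite leqNgt jl.
  have : (k <= j)%N by apply: kmin; apply/asboolP.
  by rewrite leqNgt ltn_neqAle jk jk'.
exists k, N; split; [by []..| |by left].
apply/asboolP => j jN jk; apply: contrapT => jd.
have [kj|jk'] := ltnP k j; first by apply: nol; exists j.
have : (k <= j)%N by apply: kmin; apply/asboolP.
by rewrite leqNgt ltn_neqAle jk jk'.
Qed.

Lemma vbase_double k : 2 * (M k)%:R <= (M k.+1)%:R :> R.
Proof. by rewrite vbaseS natrM mulrC ler_wpM2l// ler_nat. Qed.

Lemma sum_vbase_le l : \sum_(k < l.+1) (M k)%:R <= 2 * (M l)%:R :> R.
Proof. by apply: (@sum_doubling _ (fun k => (M k)%:R)) => // k; exact: vbase_double. Qed.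

Lemma vbaseS_le k : (M k.+1)%:R <= B%:R * (M k)%:R :> R.
Proof. by rewrite -natrM ler_nat vbaseS mulnC leq_mul2r mB orbT. Qed.

Lemma avg_agree_but_le K t k l : (l <= K)%N ->
  avg K (fun x => (agree_but x t k l)%:R : R) <= B%:R * (M l)%:R^-1.
Proof.
move=> lK; rewrite avg_agree_but// mulrC ler_wpM2r ?invr_ge0//.
by case: ifP => _; rewrite ?ler_nat// ler1n (leq_trans _ (mB 0))// ltnW.
Qed.

(** The first moment of the majorant, which gives the uniform bound of the [L_1]
    norms of the Fejer kernels. *)
Lemma avg_majorant_le K N t : (N <= K)%N ->
  avg K (fun x => majorant N x t) <= 4 * B%:R ^+ 3 * (M N)%:R.
Proof.
move=> NK; rewrite /majorant avg_sum.
apply: (@le_trans _ _ (\sum_(l < N.+1) B%:R ^+ 3 * (2 * (M l)%:R))); last first.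
  rewrite -!mulr_sumr; have := sum_vbase_le N.
  set S := \sum_(_ < _) _ => S2; rewrite [leRHS](_ : _ = B%:R ^+ 3 * (2 * (2 * (M N)%:R))); last by ring.
  by rewrite !ler_wpM2l// exprn_ge0.
apply: ler_sum => l _; rewrite avg_sum.
have lK : (l <= K)%N by rewrite (leq_trans _ NK)// -ltnS.
apply: (@le_trans _ _ (\sum_(k < l) B%:R ^+ 3 * (M k)%:R)).
  apply: ler_sum => k _; under eq_avg do rewrite mulrC.
  rewrite avgZ; apply: le_trans (ler_wpM2l _ (avg_agree_but_le _ _ lK)) _ => //.
  have Ml : (M l)%:R != 0 :> R by exact: vbase_neq0.
  rewrite natrM; apply: (@le_trans _ _ ((B%:R * (M k)%:R) * (B%:R * (M l)%:R) * (B%:R / (M l)%:R))).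
    by rewrite ler_wpM2r// ?divr_ge0// ler_pM// vbaseS_le.
  by rewrite le_eqVlt; apply/orP; left; apply/eqP; field.
rewrite -mulr_sumr ler_wpM2l ?exprn_ge0//; case: l lK => -[|l] /= _ _.
  by rewrite big_ord0 mulr_ge0.
apply: le_trans (sum_vbase_le l) _; rewrite ler_wpM2l// ler_nat.
exact: leq_vbase.
Qed.

Definition min_cst : R := B%:R ^+ 2 * lacunary_cst R.

(** The majorant is in weak [L_(1/2)], in the quantitative form that survives the
    summation of infinitely many atoms: truncated moments, unlike weak norms, are
    subadditive. *)
Lemma avg_min_majorant_le K N t c lam : (N <= K)%N -> 0 < c -> 0 < lam ->
  avg K (fun x => Num.min (c * majorant N x t) lam) <=
  min_cst * Num.sqrt (c * lam).
Proof.
move=> NK c0 lam0; set s := B%:R * Num.sqrt (c * lam).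
have Bn0 : (0 < B)%N by rewrite (leq_trans _ (mB 0))// ltnW.
have B0 : 0 < B%:R :> R by rewrite ltr0n.
have s0 : 0 < s by rewrite mulr_gt0// sqrtr_gt0 mulr_gt0.
have s2 : s ^+ 2 = c * B%:R ^+ 2 * lam.
  by rewrite exprMn sqr_sqrtr ?mulr_ge0 ?ltW//; ring.
pose a k : R := (M k)%:R * (c * B%:R ^+ 2 / s).
have q0 : 0 < c * B%:R ^+ 2 / s by rewrite divr_gt0// mulr_gt0// exprn_gt0.
have M0 k : 0 < (M k)%:R :> R by rewrite ltr0n vbase_gt0.
apply: (@le_trans _ _ (\sum_(l < N.+1) \sum_(k < l)
    B%:R * s * Num.min (a k) (a l)^-1)); last first.
  under eq_bigr do rewrite -mulr_sumr.
  rewrite -mulr_sumr (_ : min_cst * _ = B%:R * s * lacunary_cst R); last first.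
    by rewrite /min_cst /s; ring.
  rewrite ler_wpM2l ?(mulr_ge0 (ltW B0) (ltW s0))//.
  apply: (@sum_min_lacunary _ a) => k.
    exact: mulr_gt0.
  by rewrite mulrA ler_pM2r// vbase_double.
apply: (@le_trans _ _ (avg K (fun x => \sum_(l < N.+1) \sum_(k < l)
    (agree_but x t k l)%:R * Num.min (c * (M k.+1 * M l.+1)%:R) lam))).
  apply: le_avg => // x; rewrite /majorant mulr_sumr.
  apply: le_trans (min_sum_le _ _ _) _; first exact: ltW.
    by move=> l _; rewrite mulr_ge0 ?(ltW c0)// sumr_ge0.
  apply: ler_sum => l _; rewrite mulr_sumr.
  apply: le_trans (min_sum_le _ _ _) _; first exact: ltW.
    by move=> k _; rewrite mulr_ge0 ?(ltW c0).
  apply: ler_sum => k _; case: agree_but; first by rewrite !mul1r.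
  by rewrite !mul0r mulr0 ge_min lexx.
rewrite avg_sum; apply: ler_sum => l _; rewrite avg_sum; apply: ler_sum => k _.
under eq_avg do rewrite mulrC.
have lK : (l <= K)%N by rewrite (leq_trans _ NK)// -ltnS.
rewrite avgZ; apply: le_trans (ler_wpM2l _ (avg_agree_but_le _ _ lK)) _.
  by rewrite le_min (ltW lam0) andbT mulr_ge0// ltW.
rewrite mulrCA -mulrA ler_pM2l// minr_pMl ?invr_ge0 ?ler0n// minr_pMr ?(ltW s0)//.
rewrite le_min !ge_min; apply/andP; split; apply/orP; [left|right].
  rewrite ler_pdivrMr//; apply: (@le_trans _ _ (c * ((B%:R * (M k)%:R) * (B%:R * (M l)%:R)))).
    by rewrite ler_wpM2l ?(ltW c0)// natrM ler_pM// vbaseS_le.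
  rewrite le_eqVlt; apply/orP; left; apply/eqP; rewrite /a; field.
  by rewrite gt_eqF.
rewrite /a le_eqVlt; apply/orP; left; apply/eqP.
have -> : lam = s ^+ 2 / (c * B%:R ^+ 2).
  by rewrite s2; field; rewrite ?gt_eqF.
by field; rewrite ?gt_eqF.
Qed.

End majorant.

(** * The Vilenkin system *)

Section complex_norm.
Variable R : rcfType.
Implicit Types z : R[i].
Local Notation nrm := (@Normc.normc R).

Lemma normE z : `|z| = (nrm z)%:C%C.
Proof. by rewrite normc_def; case: z. Qed.

Lemma normc_le z (r : R) : (nrm z <= r) = (`|z| <= r%:C%C).
Proof. by rewrite normE lecR. Qed.

Lemma normc_le_nat z n : (nrm z <= n%:R) = (`|z| <= n%:R).
Proof. by rewrite normc_le rmorph_nat. Qed.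

Lemma normc_ge0 z : 0 <= nrm z.
Proof. by rewrite -lecR -normE rmorph0. Qed.

Lemma normc_real (r : R) : nrm r%:C%C = `|r|.
Proof. by rewrite /= expr0n/= addr0 sqrtr_sqr. Qed.

Lemma normcB z1 z2 : nrm (z1 - z2) <= nrm z1 + nrm z2.
Proof. by rewrite (le_trans (le_normcD _ _))// normcN. Qed.

Lemma normc_sum (I : Type) (r : seq I) (P : pred I) (f : I -> R[i]) :
  nrm (\sum_(i <- r | P i) f i) <= \sum_(i <- r | P i) nrm (f i).
Proof.
apply: (big_ind2 (fun z r => nrm z <= r)) => //; first by rewrite Normc.normc0.
by move=> z1 r1 z2 r2 h1 h2; rewrite (le_trans (le_normcD _ _))// lerD.
Qed.

Lemma conjE z : z^* = conjc z.
Proof. by []. Qed.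

Lemma normc_nat n : nrm n%:R = n%:R.
Proof. by rewrite -(rmorph_nat (real_complex R)) normc_real ger0_norm. Qed.

End complex_norm.

Section vilenkin_system.
Variables (R : realType) (m : nat -> nat) (m2 : forall k, (2 <= m k)%N).
Implicit Types (x t : vseq m).
Local Notation nrm := (@Normc.normc R).
Local Notation M := (vbase m).

Definition cis (t : R) : R[i] := (cos t +i* sin t)%C.

Lemma cisD (s t : R) : cis (s + t) = cis s * cis t.
Proof. by rewrite /cis cosD sinD; simpc; rewrite [sin s * _ + _]addrC. Qed.

Lemma cis0 : cis 0 = 1.
Proof. by rewrite /cis cos0 sin0. Qed.

Lemma conj_cis (t : R) : (cis t)^* = cis (- t).
Proof. by rewrite conjE /cis cosN sinN. Qed.

Lemma cisX (t : R) n : cis t ^+ n = cis (t * n%:R).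
Proof.
elim: n => [|n IH]; first by rewrite expr0 mulr0 cis0.
by rewrite exprS IH -cisD -natr1 mulrDr mulr1 addrC.
Qed.

Lemma cis2pi : cis (2 * pi) = 1.
Proof. by rewrite /cis mulrC mulr_natr cos2pi sin2pi. Qed.

Lemma normc_cis (t : R) : nrm (cis t) = 1.
Proof. by rewrite /= cos2Dsin2 sqrtr1. Qed.

(** [1 - cos s = 2 (sin (s / 2))^2] vanishes at no [s] strictly between [0] and
    [2 pi]. *)
Lemma cis_neq1 (s : R) : 0 < s < 2 * pi -> cis s != 1.
Proof.
move=> /andP[s0 s2]; apply/eqP => -[c1 _].
have sh : 0 < sin (s / 2) by apply: sin_gt0_pi; apply/andP; split; lra.
have sE : s = (s / 2) *+ 2 by rewrite -mulr_natr; field.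
by move: c1; rewrite sE cos_mulr2n cos2sin2 => c1; have := exprn_gt0 2 sh; lra.
Qed.

Definition vroot x t k : R[i] := rademacher R k (x : vgroup m) * (rademacher R k t)^*.

Lemma rademacherE k x :
  rademacher R k x = cis (2 * pi * (x k : nat)%:R / (m k)%:R).
Proof. by []. Qed.

Lemma rademacher_pow k x : rademacher R k x = cis (2 * pi / (m k)%:R) ^+ (x k : nat).
Proof. by rewrite rademacherE cisX mulrAC. Qed.

Lemma mR_gt0 k : 0 < (m k)%:R :> R.
Proof. by rewrite ltr0n ltnW. Qed.

Lemma cis_root_exp k : cis (2 * pi / (m k)%:R) ^+ m k = 1.
Proof. by rewrite cisX divfK ?cis2pi// gt_eqF// mR_gt0. Qed.

Lemma rademacher_exp k x : rademacher R k x ^+ m k = 1.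
Proof. by rewrite rademacher_pow exprAC cis_root_exp expr1n. Qed.

Lemma normc_rademacher k x : nrm (rademacher R k x) = 1.
Proof. exact: normc_cis. Qed.

Lemma vroot_exp x t k : vroot x t k ^+ m k = 1.
Proof. by rewrite exprMn -rmorphXn !rademacher_exp rmorph1 mulr1. Qed.

Lemma vroot_eq1 x t k : x k = t k -> vroot x t k = 1.
Proof.
by move=> xt; rewrite /vroot !rademacherE xt conj_cis -cisD subrr cis0.
Qed.

Lemma ltn_Zm k (d : 'Z_(m k)) : (d < m k)%N.
Proof. by have := ltn_ord d; rewrite [X in (_ < X)%N -> _]Zp_cast. Qed.

Lemma vroot_neq1 x t k : x k <> t k -> vroot x t k != 1.
Proof.
(* Conjugation exchanges the two points. *)
wlog xt : x t / (t k < x k)%N => [H xt|_].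
  have [|ltn|E] := ltngtP (t k) (x k); first by move=> ?; exact: H.
    have -> : vroot x t k = (vroot t x k)^* by rewrite /vroot rmorphM/= conjCK mulrC.
    rewrite -[X in _ != X]conjC1 (inj_eq (can_inj (@conjCK _))).
    exact: H (fun e => xt (esym e)).
  by exfalso; apply: xt; exact/val_inj.
rewrite /vroot !rademacherE conj_cis -cisD -mulrBl -mulrBr -natrB ?(ltnW xt)//.
apply: cis_neq1; rewrite divr_gt0 ?mulr_gt0 ?pi_gt0 ?mR_gt0 ?ltr0n ?subn_gt0//=.
rewrite ltr_pdivrMr ?mR_gt0// ltr_pM2l ?mulr_gt0 ?pi_gt0// ltr_nat.
by rewrite (leq_ltn_trans (leq_subr _ _))// ltn_Zm.
Qed.

Lemma vilenkinM n x t :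
  vilenkin R n (x : vgroup m) * (vilenkin R n (t : vgroup m))^* =
  vchar m (vroot x t) n.
Proof.
rewrite /vilenkin rmorph_prod -big_split/=; apply: eq_bigr => k _.
by rewrite rmorphXn exprMn.
Qed.

Lemma rademacher_depends k : depends_below k.+1 (rademacher R k : vseq m -> R[i]).
Proof. by move=> x y xy; rewrite !rademacherE xy. Qed.

Lemma vilenkin_depends n N : (n <= M N)%N ->
  forall k, (k < n)%N -> depends_below N (vilenkin R k : vseq m -> R[i]).
Proof.
move=> nN k kn x y xy; apply: eq_bigr => j _; have [jN|Nj] := ltnP j N.
  by rewrite !rademacherE xy.
by rewrite (@vdigit_small m m2 k j N)// (leq_trans kn).
Qed.

Lemma vilenkin_vbase k x : vilenkin R (M k) (x : vgroup m) = rademacher R k x.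
Proof.
rewrite /vilenkin; have kM : (k < M k)%N by exact: vbase_gt.
rewrite (bigD1 (Ordinal kM))//= big1 ?mulr1 => [|[j jM]/=].
  by rewrite /vdigit divnn vbase_gt0//= modn_small.
rewrite -(inj_eq val_inj)/= => jk; rewrite /vdigit; have [kj|kj] := ltnP k j.
  rewrite divn_small ?mod0n// (leq_trans _ (leq_vbase m2 kj))//.
  by rewrite vbaseS ltn_Pmulr// vbase_gt0.
have {kj jk} jk : (j < k)%N by rewrite ltn_neqAle jk.
rewrite -(subnKC jk) vbaseD vbaseS; set e := (\prod_(_ < _) _)%N.
by rewrite -mulnA mulKn ?vbase_gt0// modnMr.
Qed.

Lemma normc_vilenkin n x : nrm (vilenkin R n (x : vgroup m)) = 1.
Proof.
rewrite /vilenkin; elim/big_ind: _ => [|a b ha hb|k _]; first by rewrite Normc.normc1.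
  by rewrite Normc.normcM ha hb mulr1.
by elim: vdigit => [|d IH]; rewrite ?Normc.normc1// exprS Normc.normcM IH normc_rademacher mulr1.
Qed.

Lemma coord_avg_rademacher k x : coord_avg k (rademacher R k : vseq m -> R[i]) x = 0.
Proof.
set om := cis (2 * pi / (m k)%:R).
have om1 : om != 1.
  apply: cis_neq1; rewrite divr_gt0 ?mulr_gt0 ?pi_gt0 ?mR_gt0//=.
  by rewrite gtr_pMr ?mulr_gt0 ?pi_gt0// invf_lt1 ?mR_gt0// ltr1n.
have omX : om ^+ m k = 1 by exact: cis_root_exp.
rewrite /coord_avg; under eq_bigr do rewrite rademacher_pow dfwithin.
rewrite -(big_mkord xpredT (fun d => om ^+ d)) Zp_cast// big_mkord.
have /esym/eqP := subrX1 om (m k); rewrite omX subrr mulf_eq0 subr_eq0.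
by rewrite (negbTE om1) => /eqP ->; rewrite mulr0.
Qed.

Lemma coord_avg_rademacherJ k x :
  coord_avg k (fun t : vseq m => (rademacher R k t)^*) x = 0.
Proof.
rewrite /coord_avg -rmorph_sum; apply/eqP; rewrite mulf_eq0 conjC_eq0.
by have /eqP := coord_avg_rademacher k x; rewrite mulf_eq0.
Qed.

(** The bound does not depend on the index, so it is one for the maximal operator. *)
Lemma normc_fejer_majorant N x t n : ~ agree N x t -> (n <= M N)%N ->
  nrm (fejer m (vroot x t) n) <= majorant R N x t.
Proof.
move=> /differ_cases[k [l [kl lN xk xt lP]]] nM.
apply: le_trans (le_majorant R kl lN xt); rewrite normc_le_nat.
have wk := vroot_neq1 xk.
case: lP => [lE|xl].
  apply: le_trans (norm_fejer_differ m2 (vroot_exp x t) _ wk) _.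
  rewrite ler_nat mulnC leq_mul2l (leq_trans nM) ?orbT// lE.
  exact: leq_vbase.
exact: (norm_fejer_differ2 m2 (vroot_exp x t) n kl wk (vroot_neq1 xl)).
Qed.

Lemma normc_fejer_majorant_block N x t n : ~ agree N x t ->
  nrm (fejer m (vroot x t) n) <= (n %/ M N).+1%:R * majorant R N x t.
Proof.
move=> xt; have /differ_cases[k [l [kl lN xk _ _]]] := xt.
have M0 : (0 < M N)%N by exact: vbase_gt0.
rewrite {1}(divn_eq n (M N)) normc_le.
rewrite rmorphM rmorph_nat.
apply: (@norm_fejer_block _ m2 _ _ (vroot_exp x t) _ k).
- exact: leq_trans kl lN.
- exact: vroot_neq1.
- by rewrite ltnW// ltn_mod.
- by rewrite -normc_le normc_fejer_majorant.
- by rewrite -normc_le normc_fejer_majorant// ltnW// ltn_mod.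
Qed.

Lemma dirichlet_vroot N x t :
  dirichlet m (vroot x t) (M N) = (M N)%:R * (`[< agree N x t >])%:R.
Proof.
case: asboolP => xt.
  rewrite mulr1 (dirichlet_vbase m2)// => k kN.
  by rewrite vroot_eq1// xt.
have /differ_cases[k [l [kl lN xk _ _]]] := xt.
rewrite (dirichlet_eq0 m2 (vroot_exp x t) (leq_trans kl lN) (vroot_neq1 xk)).
by rewrite mulr0.
Qed.

Lemma dirichlet_depends x n N : (n <= M N)%N ->
  depends_below N (fun t => dirichlet m (vroot x t) n).
Proof.
move=> nN s t st; apply: eq_bigr => k _.
by rewrite -!vilenkinM (vilenkin_depends nN (ltn_ord k) st).
Qed.

Lemma fejer_depends x n N : (n <= M N)%N ->
  depends_below N (fun t => fejer m (vroot x t) n).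
Proof.
move=> nN s t st; apply: eq_bigr => k _; apply: (@dirichlet_depends x k N) => //.
by rewrite (leq_trans (ltnW (ltn_ord k)) nN).
Qed.

Variables (B : nat) (mB : forall k, (m k <= B)%N).

Lemma normc_avg K (h : vseq m -> R[i]) :
  nrm (avg K h) <= avg K (fun x => nrm (h x)).
Proof.
rewrite /avg Normc.normcM Normc.normcV normc_nat ler_wpM2l ?invr_ge0//.
exact: normc_sum.
Qed.

Definition fejer_cst : R := 1 + 4 * B%:R ^+ 4.

(** The [L_1] norms of the Fejer kernels are bounded: with [M N] comparable to [n],
    the diagonal cylinder contributes [n ^ 2 / M N], the majorant does the rest. *)
Lemma avg_fejer_le K x n : (n <= M K)%N ->
  avg K (fun t => nrm (fejer m (vroot x t) n)) <= fejer_cst * n%:R.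
Proof.
case: n => [_|n nK].
  rewrite mulr0 -[leRHS](avg_cst m2 K (0 : R)); apply: le_avg => t.
  by rewrite fejer0 Normc.normc0.
have ex : exists N, (n < M N)%N by exists K.
case: (ex_minnP ex) => N nN Nmin.
have NK : (N <= K)%N by exact: Nmin.
have MNle : (M N)%:R <= B%:R * n.+1%:R :> R.
  case: N Nmin {nN NK} => [|N] Nmin.
    rewrite vbase0 -natrM ler1n muln_gt0 andbT.
    by rewrite (leq_trans _ (mB 0))// ltnW.
  apply: le_trans (vbaseS_le R mB N) _; rewrite ler_wpM2l// ler_nat.
  by rewrite leqNgt; apply/negP => /ltnW/Nmin; rewrite ltnn.
apply: (@le_trans _ _ (avg K (fun t => (n.+1 ^ 2)%:R * (`[< agree N t x >])%:R +
    majorant R N t x))).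
  apply: le_avg => t; have [tx|tx] := pselect (agree N t x).
    rewrite (_ : `[< _ >] = true); last exact/asboolP.
    rewrite mulr1 -[leLHS]addr0 lerD ?majorant_ge0// normc_le_nat.
    exact: norm_fejer (vroot_exp x t) _.
  rewrite -[leLHS]add0r lerD ?mulr_ge0// majorantC normc_fejer_majorant//.
  by move/agree_sym.
rewrite avgD avgZ avg_agree//.
have diag : (n.+1 ^ 2)%:R / (M N)%:R <= n.+1%:R :> R.
  have M0 : 0 < (M N)%:R :> R by rewrite ltr0n vbase_gt0.
  rewrite ler_pdivrMr// -natrM ler_nat -mulnn leq_mul2l /=.
  exact: nN.
apply: le_trans (lerD diag (avg_majorant_le R m2 mB x NK)) _.
rewrite /fejer_cst [leRHS]mulrDl mul1r lerD2l; apply: (@le_trans _ _ (4 * B%:R ^+ 3 * (B%:R * n.+1%:R))).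
  by rewrite ler_wpM2l// mulr_ge0// exprn_ge0.
by rewrite le_eqVlt; apply/orP; left; apply/eqP; ring.
Qed.

End vilenkin_system.

(** * Martingales stopped at the heights [2 ^ i L] *)

Definition discrete_martingale (R : realType) m (f : nat -> vseq m -> R[i]) :=
  (forall n, depends_below n (f n)) /\
  (forall n x, coord_avg n (f n.+1) x = f n x).

Section stopping.
Variables (R : realType) (m : nat -> nat) (m2 : forall k, (2 <= m k)%N).
Variables (B : nat) (mB : forall k, (m k <= B)%N).
Variables (f : nat -> vseq m -> R[i]) (mf : discrete_martingale f).
Implicit Types (x t : vseq m) (L lam : R).
Local Notation nrm := (@Normc.normc R).
Local Notation M := (vbase m).

Let f_depends n : depends_below n (f n). Proof. exact: mf.1. Qed.

Lemma dfwith_self x j : dfwith x j (x j) = x.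
Proof.
apply: functional_extensionality_dep => k.
by have [<-|jk] := eqVneq j k; rewrite ?dfwithin// dfwithout.
Qed.

Lemma avg_martingale n K (h : vseq m -> R[i]) : depends_below n h -> (n <= K)%N ->
  avg K (fun x => h x * f K x) = avg n (fun x => h x * f n x).
Proof.
move=> hn; elim: K => [|K IH]; first by rewrite leqn0 => /eqP ->.
rewrite leq_eqVlt => /predU1P[->//|nK]; rewrite -IH// avgS; apply: eq_avg => x.
by rewrite coord_avgM ?mf.2// => y d; exact: depends_dfwith hn nK.
Qed.

Lemma avg_increment j K (h : vseq m -> R[i]) : depends_below j h -> (j < K)%N ->
  avg K (fun x => h x * (f j.+1 x - f j x)) = 0.
Proof.
move=> hj jK; have hj1 : depends_below j.+1 h by exact: depends_leq hj.
have fj1 : depends_below j.+1 (f j) by exact: (depends_leq (leqnSn j)).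
rewrite (@avg_depends _ m2 _ j.+1)//; last first.
  by move=> x y xy; rewrite (hj1 x y)// (f_depends xy) (fj1 x y).
under eq_avg do rewrite mulrBr.
rewrite avgB (@avg_martingale j)//; apply/eqP; rewrite subr_eq0; apply/eqP.
rewrite [RHS](@avg_depends _ m2 _ j)// => x y xy.
by rewrite (hj x y)// (f_depends xy).
Qed.

(** Stopping one step before the height [L] may be exceeded, rather than when it is
    exceeded, keeps the stopped martingale below [L]. *)
Definition stopped (L : R) j x : bool :=
  `[< exists i (d : 'Z_(m i)), (i <= j)%N /\ L < nrm (f i.+1 (dfwith x i d)) >].

Definition first_stopped (L : R) N x : bool :=
  stopped L N x && ~~ ((0 < N)%N && stopped L N.-1 x).

Definition stop (L : R) K x : R[i] :=
  f 0%N x + \sum_(j < K) (~~ stopped L j x)%:R * (f j.+1 x - f j x).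

Lemma stopped_leq L j j' x : (j <= j')%N -> stopped L j x -> stopped L j' x.
Proof.
move=> jj /asboolP[i [d [ij Lf]]]; apply/asboolP; exists i, d; split=> //.
exact: leq_trans jj.
Qed.

Lemma stopped_le L L' j x : L <= L' -> stopped L' j x -> stopped L j x.
Proof.
move=> LL /asboolP[i [d [ij Lf]]]; apply/asboolP; exists i, d; split=> //.
exact: le_lt_trans Lf.
Qed.

Lemma stopped_depends L j : depends_below j (stopped L j).
Proof.
suff H x y : agree j x y -> stopped L j x -> stopped L j y.
  by move=> x y xy; apply/idP/idP; apply: H => //; exact: agree_sym.
move=> xy /asboolP[i [d [ij Lf]]]; apply/asboolP; exists i, d; split=> //.
rewrite -(_ : f i.+1 (dfwith x i d) = f i.+1 (dfwith y i d))//.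
apply: f_depends => k; rewrite ltnS leq_eqVlt => /predU1P[->|ki].
  by rewrite !dfwithin.
by rewrite !dfwithout ?gtn_eqF// xy// (leq_trans ki).
Qed.

Lemma first_stopped_depends L N : depends_below N (first_stopped L N).
Proof.
move=> x y xy; rewrite /first_stopped (stopped_depends L xy).
case: N xy => //= N xy.
by rewrite (@stopped_depends L N x y)//; exact: agree_leq xy.
Qed.

Lemma first_stoppedP L N x j : first_stopped L N x -> (j < N)%N -> ~~ stopped L j x.
Proof.
move=> /andP[_]; case: N => // N /= nN; rewrite ltnS => jN.
by apply: contra nN; exact: stopped_leq.
Qed.

Lemma sum_first_stopped (F : pzSemiRingType) L K x :
  \sum_(N < K.+1) (first_stopped L N x)%:R = (stopped L K x)%:R :> F.
Proof.
elim: K => [|K IH]; first by rewrite big_ord1 /first_stopped /= andbT.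
rewrite big_ord_recr/= IH /first_stopped/=.
have := @stopped_leq L K K.+1 x (leqnSn K).
by case: (stopped L K x) => [->//|_]; rewrite ?andbF ?addr0// andbT add0r.
Qed.

Lemma not_stopped_le L j x : ~~ stopped L j x -> nrm (f j.+1 x) <= L.
Proof.
move=> ns; rewrite leNgt; apply: contra ns => Lf; apply/asboolP.
by exists j, (x j); rewrite dfwith_self.
Qed.

Lemma stop_not_stopped L K x : (forall j, (j < K)%N -> ~~ stopped L j x) ->
  stop L K x = f K x.
Proof.
move=> ns; rewrite /stop.
under eq_bigr => j _ do rewrite ns ?ltn_ord// mul1r.
by rewrite -(big_mkord xpredT (fun j => f j.+1 x - f j x)) telescope_sumr// addrC subrK.
Qed.

Lemma stop_le L K x : nrm (f 0%N x) <= L -> nrm (stop L K x) <= L.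
Proof.
move=> f0; elim: K => [|K IH]; first by rewrite /stop big_ord0 addr0.
have [st|ns] := boolP (stopped L K x).
  by rewrite /stop big_ord_recr/= st mul0r addr0.
rewrite stop_not_stopped ?not_stopped_le// => j jK; apply: contra ns.
exact: stopped_leq.
Qed.

Definition layer (L : R) K x : R[i] := stop (2 * L) K x - stop L K x.

Lemma layerE L K x : 0 <= L -> layer L K x =
  \sum_(j < K) (stopped L j x && ~~ stopped (2 * L) j x)%:R * (f j.+1 x - f j x).
Proof.
move=> L0; rewrite /layer /stop opprD addrACA subrr add0r -sumrB.
apply: eq_bigr => j _; rewrite -mulrBl; congr (_ * _).
have : stopped (2 * L) j x -> stopped L j x by apply: stopped_le; lra.
case: (stopped (2 * L) j x) => [->//|_] /=; first by rewrite subrr.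
by case: (stopped L j x); rewrite /= ?subr0 ?subrr.
Qed.

Lemma layer_le L K x : nrm (f 0%N x) <= L -> nrm (layer L K x) <= 3 * L.
Proof.
move=> f0; have L0 : 0 <= L by exact: le_trans (normc_ge0 _) f0.
apply: le_trans (normcB _ _) _; have := stop_le K f0.
have := @stop_le (2 * L) K x (_ : nrm (f 0%N x) <= 2 * L); lra.
Qed.

Lemma stop_layers L K n x :
  stop (2 ^+ n * L) K x = stop L K x + \sum_(i < n) layer (2 ^+ i * L) K x.
Proof.
elim: n => [|n IH]; first by rewrite big_ord0 addr0 expr0 mul1r.
by rewrite big_ord_recr/= addrA -IH /layer exprS -mulrA addrC subrK.
Qed.

Lemma le_sum_reps N (h : vseq m -> R) x : depends_below N h ->
  (forall y, 0 <= h y) -> h x <= \sum_(y <- reps m N) h y.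
Proof.
move=> hN h0; rewrite -(sum_reps_agree m2 x hN); apply: ler_sum => y _.
by rewrite ler_piMr// lern1 leq_b1.
Qed.

(** The functions [f 1], ..., [f K] take finitely many values, so that high levels are
    not reached before the time [K]. *)
Lemma stop_eventually L K : 0 < L -> exists n, forall x, stop (2 ^+ n * L) K x = f K x.
Proof.
move=> L0; set S : R := \sum_(i < K) \sum_(y <- reps m i.+1) nrm (f i.+1 y).
have fS i x : (i < K)%N -> nrm (f i.+1 x) <= S.
  move=> iK; rewrite /S (bigD1 (Ordinal iK))//= -[leLHS]addr0 lerD//.
    apply: (@le_sum_reps i.+1 (fun y => nrm (f i.+1 y)) x) => [y z yz|y].
      by rewrite (f_depends yz).
    exact: normc_ge0.
  by apply: sumr_ge0 => j _; apply: sumr_ge0 => y _; exact: normc_ge0.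
exists (Num.truncn (S / L)).+1 => x; apply: stop_not_stopped => j jK.
apply/asboolPn => -[i [d [ij]]]; apply/negP; rewrite -leNgt.
apply: (le_trans (fS _ _ (leq_ltn_trans ij jK))).
rewrite -ler_pdivrMr//; apply: le_trans (ltW (truncnS_gt _)) _.
by rewrite -natrX ler_nat ltnW// ltn_expl.
Qed.

(** On a cylinder where stopping at [L] begins, a layer contains only later increments
    of the martingale.  This is the cancellation of an atom. *)
Lemma avg_layer_atom L K N (h : vseq m -> R[i]) : 0 <= L -> (N <= K)%N ->
  depends_below N h ->
  avg K (fun t => (first_stopped L N t)%:R * layer L K t * h t) = 0.
Proof.
move=> L0 NK hN.
under eq_avg do rewrite layerE// mulr_sumr mulr_suml.
rewrite avg_sum big1// => j _.
have [jN|Nj] := ltnP j N.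
  rewrite -[RHS](avg_cst m2 K 0); apply: eq_avg => t.
  have [fs|] := boolP (first_stopped L N t); last by rewrite !mul0r.
  by rewrite (negbTE (first_stoppedP fs jN)) mul0r mulr0 mul0r.
rewrite -(@avg_increment j K (fun t => (first_stopped L N t)%:R * h t *
    (stopped L j t && ~~ stopped (2 * L) j t)%:R))//.
  by apply: eq_avg => t; ring.
move=> s t st; rewrite !(@stopped_depends _ j s t)//.
have stN := agree_leq Nj st.
by rewrite (first_stopped_depends L stN) (hN s t).
Qed.

Definition fejer_sum K n x : R[i] :=
  avg K (fun t => f K t * fejer m (vroot R x t) n).

Lemma first_stopped_differ L L' K N x t : L <= L' -> (N <= K)%N ->
  ~~ stopped L K x -> first_stopped L' N t -> ~ agree N x t.
Proof.
move=> LL NK nx /andP[st _] xt; move/negP: nx; apply.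
apply: (stopped_leq NK); apply: (stopped_le LL).
by rewrite (stopped_depends L' xt).
Qed.

(** On an atom only the kernels of index larger than the order of its cylinder
    contribute, and for these the division by [n] gains the factor [M N]. *)
Lemma normc_avg_atom L L' K N n x : (N <= K)%N -> 0 < L -> L <= L' ->
  nrm (f 0%N x) <= L -> ~~ stopped L K x ->
  nrm (avg K.+1 (fun t => (first_stopped L' N t)%:R * layer L' K.+1 t *
        fejer m (vroot R x t) n)) <=
  n%:R * \sum_(t <- reps m N) (first_stopped L' N t)%:R *
           (6 * L' * (M N)%:R ^- 2 * majorant R N x t).
Proof.
move=> NK L0 LL f0 nx; have L'0 : 0 <= L' by rewrite (le_trans (ltW L0)).
have M0 : 0 < (M N)%:R :> R by rewrite ltr0n vbase_gt0.
have rhs0 : 0 <= n%:R * \sum_(t <- reps m N) (first_stopped L' N t)%:R *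
    (6 * L' * (M N)%:R ^- 2 * majorant R N x t).
  rewrite mulr_ge0// sumr_ge0// => t _.
  by rewrite !mulr_ge0 ?invr_ge0 ?exprn_ge0 ?majorant_ge0 ?(ltW M0).
have f0t t : nrm (f 0%N t) <= L'.
  by rewrite (_ : f 0%N t = f 0%N x) ?(le_trans f0)//; apply: f_depends.
have [nM|Mn] := leqP n (M N).
  by rewrite (avg_layer_atom L'0 (leqW NK) (@fejer_depends R m m2 x n N nM)) Normc.normc0.
apply: le_trans (normc_avg _ _) _.
apply: (@le_trans _ _ (avg K.+1 (fun t => (first_stopped L' N t)%:R *
    (3 * L' * (2 * (n%:R / (M N)%:R)) * majorant R N x t)))).
  apply: le_avg => t; rewrite !Normc.normcM normc_nat.
  have [fs|] := boolP (first_stopped L' N t); last by rewrite !mul0r.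
  have xt := first_stopped_differ LL NK nx fs.
  rewrite !mul1r -mulrA ler_pM ?normc_ge0 ?(layer_le _ (f0t t))//.
  apply: le_trans (normc_fejer_majorant_block R m2 n xt) _.
  rewrite ler_wpM2r ?majorant_ge0//.
  have q1 : (0 < n %/ M N)%N by rewrite divn_gt0 ?vbase_gt0// ltnW.
  apply: (@le_trans _ _ (2 * (n %/ M N)%:R)).
    by rewrite -natrM ler_nat mul2n -addnn -addn1 leq_add2l.
  by rewrite ler_pM2l// ler_pdivlMr// -natrM ler_nat leq_divM.
rewrite (@avg_depends _ m2 _ N) ?(leqW NK)//; last first.
  move=> s t st; rewrite (first_stopped_depends L' st) ![majorant R N x _]majorantC.
  by rewrite (majorant_depends R x st).
rewrite /avg [leLHS]mulr_sumr [leRHS]mulr_sumr; apply: ler_sum => t _.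
rewrite le_eqVlt; apply/orP; left; apply/eqP; field.
by rewrite gt_eqF.
Qed.

Definition atom_sum (L : R) I K x : R :=
  \sum_(i < I) \sum_(N < K.+1) \sum_(t <- reps m N)
    (first_stopped (2 ^+ i * L) N t)%:R *
    (6 * (2 ^+ i * L) * (M N)%:R ^- 2 * majorant R N x t).

Lemma atom_ge0 L N x t : 0 <= L ->
  0 <= 6 * L * (M N)%:R ^- 2 * majorant R N x t.
Proof.
by move=> L0; rewrite !mulr_ge0 ?invr_ge0 ?exprn_ge0 ?majorant_ge0.
Qed.

Lemma atom_sum_ge0 L I K x : 0 <= L -> 0 <= atom_sum L I K x.
Proof.
move=> L0; apply: sumr_ge0 => i _; apply: sumr_ge0 => N _; apply: sumr_ge0 => t _.
by rewrite mulr_ge0// atom_ge0// mulr_ge0// exprn_ge0.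
Qed.

Lemma scaled_ge L i : 0 < L -> L <= 2 ^+ i * L.
Proof. by move=> L0; rewrite ler_peMl ?(ltW L0)// exprn_ege1// ler1n. Qed.

(** Away from the stopping set, the stopped martingale is bounded and the rest is a
    sum of atoms carried by cylinders that do not contain [x]. *)
Lemma fejer_sum_le L K n x I : 0 < L -> (n <= M K.+1)%N ->
  nrm (f 0%N x) <= L -> ~~ stopped L K x ->
  (forall t, stop (2 ^+ I * L) K.+1 t = f K.+1 t) ->
  nrm (fejer_sum K.+1 n x) <= n%:R * (fejer_cst R B * L + atom_sum L I K x).
Proof.
move=> L0 nM f0 nx HI.
have f0t t : nrm (f 0%N t) <= L.
  by rewrite (_ : f 0%N t = f 0%N x)//; apply: f_depends.
have layer_first L' t : 0 <= L' ->
    layer L' K.+1 t = \sum_(N < K.+1) (first_stopped L' N t)%:R * layer L' K.+1 t.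
  move=> L'0; rewrite -mulr_suml sum_first_stopped.
  have [st|ns] := boolP (stopped L' K t); first by rewrite mul1r.
  rewrite mul0r layerE// big1// => j _.
  rewrite (_ : stopped L' j t = false) ?mul0r//.
  by apply: contraNF ns; apply: stopped_leq; rewrite -ltnS.
have -> : fejer_sum K.+1 n x =
    avg K.+1 (fun t => stop L K.+1 t * fejer m (vroot R x t) n) +
    \sum_(i < I) \sum_(N < K.+1) avg K.+1 (fun t =>
      (first_stopped (2 ^+ i * L) N t)%:R * layer (2 ^+ i * L) K.+1 t *
      fejer m (vroot R x t) n).
  under [X in _ + X]eq_bigr do rewrite -avg_sum.
  rewrite -avg_sum -avgD; apply: eq_avg => t.
  rewrite -HI stop_layers mulrDl mulr_suml; congr (_ + _); apply: eq_bigr => i _.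
  rewrite {1}layer_first ?mulr_suml// mulr_ge0 ?exprn_ge0// ltW//.
apply: le_trans (le_normcD _ _) _; rewrite mulrDr lerD//.
  apply: le_trans (normc_avg _ _) _.
  apply: (@le_trans _ _ (avg K.+1 (fun t => L * nrm (fejer m (vroot R x t) n)))).
    apply: le_avg => t; rewrite Normc.normcM ler_wpM2r ?normc_ge0//.
    exact: stop_le.
  rewrite avgZ mulrC; apply: le_trans (ler_wpM2r (ltW L0) (avg_fejer_le R m2 mB x nM)) _.
  by rewrite le_eqVlt; apply/orP; left; apply/eqP; ring.
apply: le_trans (normc_sum _ _ _) _; rewrite mulr_sumr; apply: ler_sum => i _.
apply: le_trans (normc_sum _ _ _) _; rewrite mulr_sumr; apply: ler_sum => N _.
apply: (normc_avg_atom _ _ L0 _ f0 nx) => //; first by rewrite -ltnS.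
exact: scaled_ge.
Qed.

Definition max_upto K x : R := \big[Num.max/0]_(j < K.+1) nrm (f j x).

Lemma le_max_upto K j x : (j <= K)%N -> nrm (f j x) <= max_upto K x.
Proof.
move=> jK; have jK1 : (j < K.+1)%N by [].
exact: (le_bigmax_cond 0 (fun j : 'I_K.+1 => nrm (f j x))
  (isT : xpredT (Ordinal jK1))).
Qed.

Lemma max_upto_ge0 K x : 0 <= max_upto K x.
Proof. exact: le_trans (normc_ge0 _) (@le_max_upto K 0%N x _). Qed.

(** Regularity of the filtration: a cylinder which is stopped contains one of the
    next order, so of at least [1 / B] of its measure, where [f] is large. *)
Lemma avg_first_stopped_le L K N : (N <= K)%N ->
  avg K.+1 (fun x => (first_stopped L N x)%:R : R) <=
  B%:R * avg K.+1 (fun x => (first_stopped L N x)%:R * (L < nrm (f N.+1 x))%R%:R).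
Proof.
move=> NK; rewrite -[in leRHS](@avg_coord_avg _ m2 _ K.+1 N)// -avgZ; apply: le_avg => x.
rewrite coord_avgM => [|y d]; last first.
  by rewrite (depends_dfwith _ _ (@first_stopped_depends L N)).
have [fs|] := boolP (first_stopped L N x); last by rewrite !mul0r mulr0.
rewrite !mul1r /coord_avg mulrA; apply: (@le_trans _ _ (\sum_(d : 'Z_(m N))
    (L < nrm (f N.+1 (dfwith x N d)))%R%:R)); last first.
  by rewrite ler_peMl ?sumr_ge0// ler_pdivlMr ?mR_gt0// mul1r ler_nat.
have [i [d [iN Lf]]] : exists i (d : 'Z_(m i)), (i <= N)%N /\ L < nrm (f i.+1 (dfwith x i d)).
  by case/andP: fs => /asboolP.
have iE : i = N.
  apply/eqP; rewrite eqn_leq iN leqNgt; apply/negP => iN'.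
  by have /asboolPn := first_stoppedP fs iN'; apply; exists i, d.
subst i; rewrite (bigD1 d)//= Lf lerDl sumr_ge0//.
Qed.

Lemma avg_stopped_le L K : avg K.+1 (fun x => (stopped L K x)%:R : R) <=
  B%:R * avg K.+1 (fun x => (L < max_upto K.+1 x)%R%:R).
Proof.
under eq_avg do rewrite -sum_first_stopped.
rewrite avg_sum; apply: (@le_trans _ _ (\sum_(N < K.+1) B%:R * avg K.+1
    (fun x => (first_stopped L N x)%:R * (L < max_upto K.+1 x)%R%:R))).
  apply: ler_sum => N _; have NK : (N <= K)%N by rewrite -ltnS.
  apply: le_trans (avg_first_stopped_le L NK) _; rewrite ler_wpM2l//.
  apply: le_avg => x; rewrite ler_wpM2l// ler_nat.
  have [Lf|//] := ltP L (nrm (f N.+1 x)).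
  by rewrite (lt_le_trans Lf)// le_max_upto.
rewrite -mulr_sumr -avg_sum ler_wpM2l//; apply: le_avg => x.
by rewrite -mulr_suml sum_first_stopped ler_piMl// lern1 leq_b1.
Qed.

Lemma sum_pow_lt_le (r y : R) n : 1 < r -> 0 <= y ->
  \sum_(i < n) r ^+ i * (r ^+ i < y)%R%:R <= y * (r / (r - 1)).
Proof.
move=> r1 y0; have r0 : 0 < r by lra.
have q0 : 0 < r - 1 by lra.
elim: n => [|n IH]; first by rewrite big_ord0 mulr_ge0// divr_ge0// ltW.
rewrite big_ord_recr/=; case: ltP => ry; last by rewrite mulr0 addr0.
apply: (@le_trans _ _ (\sum_(i < n.+1) r ^+ i)).
  rewrite big_ord_recr/= mulr1 lerD2r; apply: ler_sum => i _.
  by rewrite ler_piMr ?exprn_ge0 ?(ltW r0)// lern1 leq_b1.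
rewrite mulrA ler_pdivlMr//; have := subrX1 r n.+1; rewrite mulrC => <-.
have : r ^+ n * r <= y * r by rewrite ler_pM2r// ltW.
by rewrite exprSr; lra.
Qed.

Definition weak_cst : R :=
  B%:R * Num.sqrt (2 * fejer_cst R B) +
  2 * min_cst R B * B%:R * Num.sqrt 3 * (Num.sqrt 2 / (Num.sqrt 2 - 1)).

Lemma min_cst_ge0 : 0 <= min_cst R B.
Proof.
have s2 := sqrt2_gt1 R.
rewrite /min_cst /lacunary_cst mulr_ge0 ?exprn_ge0// mulr_ge0// invr_ge0 subr_ge0.
by rewrite invf_le1 ?(ltW s2)// (lt_trans ltr01).
Qed.

Lemma weak_cst_ge0 : 0 <= weak_cst.
Proof.
have s2 := sqrt2_gt1 R; have c0 := min_cst_ge0.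
have q0 : 0 <= Num.sqrt 2 / (Num.sqrt 2 - 1) :> R.
  by rewrite divr_ge0 ?sqrtr_ge0// subr_ge0 ltW.
have h1 : 0 <= B%:R * Num.sqrt (2 * fejer_cst R B) :> R.
  exact: mulr_ge0 (sqrtr_ge0 _).
have h2 : 0 <= 2 * min_cst R B * B%:R :> R.
  exact: mulr_ge0 (mulr_ge0 (ler0n _ 2) c0) (ler0n _ B).
exact: addr_ge0 h1 (mulr_ge0 (mulr_ge0 h2 (sqrtr_ge0 _)) q0).
Qed.

(** The truncation passes to the single atoms.  Each of them contributes the square
    root of its height times the measure of its cylinder, so that what remains is a
    sum over [i] of the square root of [2 ^ i * L] times the measure of the set where
    the maximal function exceeds [2 ^ i * L]. *)
Lemma avg_min_atom_sum L lam I K : 0 < L -> 0 < lam ->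
  avg K.+1 (fun x => Num.min (atom_sum L I K x) (lam / 2)) <=
  min_cst R B * B%:R * Num.sqrt (3 * lam) * (Num.sqrt 2 / (Num.sqrt 2 - 1)) *
  avg K.+1 (fun x => Num.sqrt (max_upto K.+1 x)).
Proof.
move=> L0 lam0; set q := Num.sqrt 2 / _; set c1 := min_cst R B.
have lam20 : 0 < lam / 2 by rewrite divr_gt0.
have Li0 i : 0 < 2 ^+ i * L by rewrite mulr_gt0// exprn_gt0.
have M0 N : 0 < (M N)%:R :> R by rewrite ltr0n vbase_gt0.
have c10 : 0 <= c1 by exact: min_cst_ge0.
apply: (@le_trans _ _ (\sum_(i < I) c1 * Num.sqrt (3 * lam * (2 ^+ i * L)) *
    avg K.+1 (fun x => (stopped (2 ^+ i * L) K x)%:R))).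
  apply: (@le_trans _ _ (avg K.+1 (fun x => \sum_(i < I) \sum_(N < K.+1)
      \sum_(t <- reps m N) (first_stopped (2 ^+ i * L) N t)%:R *
        Num.min (6 * (2 ^+ i * L) * (M N)%:R ^- 2 * majorant R N x t) (lam / 2)))).
    have c0 i N x t : 0 <= 6 * (2 ^+ i * L) * (M N)%:R ^- 2 * majorant R N x t.
      exact: atom_ge0 (ltW (Li0 i)).
    apply: le_avg => x; apply: le_trans (min_sum_le _ (ltW lam20) _) _ => [i _|].
      by apply: sumr_ge0 => N _; apply: sumr_ge0 => t _; rewrite mulr_ge0.
    apply: ler_sum => i _; apply: le_trans (min_sum_le _ (ltW lam20) _) _ => [N _|].
      by apply: sumr_ge0 => t _; rewrite mulr_ge0.
    apply: ler_sum => N _; apply: le_trans (min_sum_le _ (ltW lam20) _) _ => [t _|].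
      by rewrite mulr_ge0.
    apply: ler_sum => t _; case: first_stopped; first by rewrite !mul1r.
    by rewrite !mul0r ge_min lexx.
  rewrite avg_sum; apply: ler_sum => i _.
  under [in leRHS]eq_avg do rewrite -sum_first_stopped.
  rewrite !avg_sum mulr_sumr; apply: ler_sum => N _.
  have NK : (N <= K.+1)%N by exact: ltnW.
  rewrite avg_sum [in leRHS](@avg_depends _ m2 _ N)//; last first.
    by move=> x y xy; rewrite (first_stopped_depends _ xy).
  rewrite [in leRHS]/avg !mulr_sumr; apply: ler_sum => t _; rewrite avgZ.
  case: first_stopped; last by rewrite !mulr0 mul0r.
  rewrite mul1r mulr1.
  apply: le_trans (avg_min_majorant_le m2 mB t NK _ lam20) _.
    by rewrite !mulr_gt0 ?invr_gt0 ?exprn_gt0.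
  rewrite -/c1 -[leRHS]mulrA ler_wpM2l// (_ : _ * (lam / 2) = 3 * lam * (2 ^+ i * L) * (M N)%:R ^- 2).
    rewrite sqrtrM; last by rewrite !mulr_ge0 ?exprn_ge0 ?ltW.
    by rewrite -exprVn sqrtr_sqr ger0_norm// invr_ge0 ltW.
  by field; rewrite gt_eqF.
apply: (@le_trans _ _ (c1 * B%:R * Num.sqrt (3 * lam) * avg K.+1 (fun x =>
    Num.sqrt L * \sum_(i < I) Num.sqrt 2 ^+ i *
      (Num.sqrt 2 ^+ i < Num.sqrt (max_upto K.+1 x / L))%R%:R))).
  under [in leRHS]eq_avg do rewrite mulr_sumr.
  rewrite avg_sum mulr_sumr; apply: ler_sum => i _.
  rewrite [leRHS](_ : _ = c1 * Num.sqrt (3 * lam * (2 ^+ i * L)) * (B%:R *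
      avg K.+1 (fun x => (2 ^+ i * L < max_upto K.+1 x)%R%:R))).
    apply: ler_wpM2l; first by rewrite mulr_ge0 ?sqrtr_ge0.
    exact: avg_stopped_le.
  rewrite [Num.sqrt (_ * (_ * L))]sqrtrM ?mulr_ge0 ?(ltW lam0)//.
  rewrite [Num.sqrt (_ * L)]sqrtrM ?exprn_ge0//.
  have sX : Num.sqrt (2 ^+ i) = Num.sqrt 2 ^+ i :> R.
    by elim: (nat_of_ord i) => [|k IH]; rewrite ?expr0 ?sqrtr1// !exprS sqrtrM// IH.
  rewrite sX; under eq_avg do rewrite mulrA.
  rewrite avgZ [avg _ _](_ : _ = avg K.+1 (fun x => (2 ^+ i * L < max_upto K.+1 x)%R%:R)).
    by ring.
  apply: eq_avg => x; rewrite -sX; have := max_upto_ge0 K.+1 x.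
  rewrite le_eqVlt => /predU1P[<-|fx0].
    by rewrite mul0r sqrtr0 !ltNge sqrtr_ge0 (ltW (Li0 i)).
  by rewrite ltr_sqrt ?divr_gt0// ltr_pdivlMr.
rewrite -[leRHS]mulrA; apply: ler_wpM2l.
  by apply: mulr_ge0; [exact: mulr_ge0|exact: sqrtr_ge0].
rewrite -avgZ; apply: le_avg => x.
have s2 := sqrt2_gt1 R.
apply: le_trans (ler_wpM2l (sqrtr_ge0 L) (sum_pow_lt_le I s2 (sqrtr_ge0 _))) _.
have E : Num.sqrt L * Num.sqrt (max_upto K.+1 x / L) = Num.sqrt (max_upto K.+1 x).
  by rewrite -sqrtrM ?(ltW L0)// [L * _]mulrC divfK ?gt_eqF.
by rewrite [leLHS]mulrA E mulrC.
Qed.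

(** The height [L] is such that the Fejer means of the martingale stopped at [L] are at
    most [lam / 2].  Hence a large Fejer mean of [f] requires that [x] be stopped or
    that the atoms contribute [lam / 2].  The constant does not depend on [K]. *)
Lemma weak_type_fejer lam K : 0 < lam ->
  avg K.+1 (fun x => (`[< exists n, [/\ (0 < n)%N, (n <= M K.+1)%N &
      n%:R * lam < nrm (fejer_sum K.+1 n x)] >])%:R) <=
  weak_cst / Num.sqrt lam * avg K.+1 (fun x => Num.sqrt (max_upto K.+1 x)).
Proof.
move=> lam0; set C1 := fejer_cst R B; set J := avg _ (fun x => Num.sqrt _).
have C10 : 0 < C1.
  by rewrite /C1 /fejer_cst; have : 0 <= B%:R ^+ 4 :> R by exact: exprn_ge0; lra.
set L := lam / (2 * C1); have L0 : 0 < L by rewrite divr_gt0// mulr_gt0.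
have J0 : 0 <= J by apply: avg_ge0 => // x; exact: sqrtr_ge0.
have sl0 : 0 < Num.sqrt lam by rewrite sqrtr_gt0.
have sL0 : 0 < Num.sqrt L by rewrite sqrtr_gt0.
set c1 := 2 * min_cst R B * B%:R * Num.sqrt 3 * (Num.sqrt 2 / (Num.sqrt 2 - 1)).
have s2 := sqrt2_gt1 R.
have c10 : 0 <= c1.
  have q0 : 0 <= Num.sqrt 2 / (Num.sqrt 2 - 1) :> R.
    by rewrite divr_ge0 ?sqrtr_ge0// subr_ge0 ltW.
  have h : 0 <= 2 * min_cst R B * B%:R.
    exact: mulr_ge0 (mulr_ge0 (ler0n _ 2) min_cst_ge0) (ler0n _ B).
  exact: mulr_ge0 (mulr_ge0 h (sqrtr_ge0 _)) q0.
have wE : weak_cst / Num.sqrt lam = B%:R / Num.sqrt L + c1 / Num.sqrt lam.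
  have -> : Num.sqrt L = Num.sqrt lam / Num.sqrt (2 * C1).
    by rewrite [in LHS]/L sqrtrM ?(ltW lam0)// sqrtrV// mulr_ge0// ltW.
  by rewrite /weak_cst mulrDl -/C1 -/c1 invf_div mulrA.
have chebyshev : avg K.+1 (fun x => (L < max_upto K.+1 x)%R%:R) <= (Num.sqrt L)^-1 * J.
  rewrite /J -avgZ; apply: le_avg => x; case: ltP => Lx; last first.
    by rewrite mulr_ge0 ?invr_ge0 ?sqrtr_ge0.
  by rewrite ler_pdivlMl// mulr1 ler_wsqrtr// ltW.
rewrite wE mulrDl.
have [f0|f0] := ltP L (nrm (f 0%N (fun=> 0))).
  rewrite -[leLHS]addr0 lerD//; last by rewrite mulr_ge0// divr_ge0// ltW.
  apply: (@le_trans _ _ (avg K.+1 (fun x => (L < max_upto K.+1 x)%R%:R))).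
    apply: le_avg => x; rewrite ler_nat; case: asboolP => // _.
    rewrite lt0b; apply: lt_le_trans (le_max_upto x (leq0n _)).
    by rewrite (_ : f 0%N x = f 0%N (fun=> 0))//; apply: f_depends.
  apply: le_trans chebyshev _; rewrite -mulrA; apply: ler_peMl.
    by rewrite mulr_ge0// invr_ge0 ltW.
  by rewrite ler1n (leq_trans _ (mB 0))// ltnW.
have f0x x : nrm (f 0%N x) <= L.
  by rewrite (_ : f 0%N x = f 0%N (fun=> 0))//; apply: f_depends.
have [I HI] := stop_eventually K.+1 L0.
apply: (@le_trans _ _ (avg K.+1 (fun x => (stopped L K x)%:R +
    2 / lam * Num.min (atom_sum L I K x) (lam / 2)))).
  apply: le_avg => x; have [st|ns] := boolP (stopped L K x).
    rewrite -[leLHS]addr0 lerD ?lern1 ?leq_b1//.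
    rewrite mulr_ge0 ?divr_ge0 ?(ltW lam0)// le_min divr_ge0 ?(ltW lam0)// andbT.
    exact: atom_sum_ge0 (ltW L0).
  rewrite add0r; case: asboolP => [[n [n0 nM]]|_]; last first.
    rewrite mulr_ge0 ?divr_ge0 ?(ltW lam0)// le_min divr_ge0 ?(ltW lam0)// andbT.
    exact: atom_sum_ge0 (ltW L0).
  move=> /lt_le_trans /(_ (fejer_sum_le L0 nM (f0x x) ns HI)).
  rewrite ltr_pM2l ?ltr0n// -/C1 (_ : C1 * L = lam / 2); last first.
    by rewrite /L; field; rewrite gt_eqF.
  move=> h; rewrite min_r; last by lra.
  by rewrite mulrA divfK ?divff// gt_eqF.
rewrite avgD avgZ lerD//.
  apply: le_trans (avg_stopped_le L K) _.
  by rewrite -mulrA ler_wpM2l.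
apply: le_trans (ler_wpM2l _ (avg_min_atom_sum I K L0 lam0)) _.
  by rewrite divr_ge0// ltW.
rewrite -/J mulrA ler_wpM2r// sqrtrM// le_eqVlt; apply/orP; left; apply/eqP.
have lamE : lam = Num.sqrt lam ^+ 2 by rewrite sqr_sqrtr// ltW.
rewrite {1}lamE /c1; field.
by rewrite gt_eqF//= gt_eqF// subr_gt0.
Qed.

End stopping.

(** * From averages to integrals *)

Section bridge.
Variables (R : realType) (m : nat -> nat) (m2 : forall k, (2 <= m k)%N).
Variables (mu : probability (vgroup m) R) (hmu : is_product_measure mu).
Implicit Types (x y : vseq m) (f : nat -> vgroup m -> R[i]).
Local Notation nrm := (@Normc.normc R).
Local Notation M := (vbase m).

Lemma measurable_cylinder n x : measurable (cylinder n x : set (vgroup m)).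
Proof. by apply: sub_gen_smallest; exists n, x. Qed.

Lemma mu_cylinder n x : mu (cylinder n x) = ((M n)%:R^-1)%:E.
Proof.
have -> : (cylinder n x : set (vgroup m)) =
    [set y : vseq m | forall k, (k < n)%N -> y k \in [set x k]%SET].
  apply/seteqP; split=> y yx k kn; first by apply/set1P; exact: yx.
  exact/set1P/yx.
rewrite hmu /vbase natr_prod -prodfV; congr EFin.
by apply: eq_bigr => k _; rewrite cards1 mul1r.
Qed.

Lemma sum_cylinders N (h : vseq m -> R) : depends_below N h ->
  h = fun y => \sum_(x <- reps m N) h x * \1_(cylinder N x : set (vgroup m)) y.
Proof.
move=> hN; apply: funext => y; rewrite -[LHS](sum_reps_agree m2 y hN).
apply: eq_bigr => x _; congr (_ * _); rewrite indicE; congr ((nat_of_bool _)%:R).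
apply/asboolP/idP => [xy|/set_mem yx]; first by apply/mem_set => k kN; rewrite xy.
by move=> k kN; rewrite yx.
Qed.

Lemma integral_sum_cylinders N (h : vseq m -> R) (s : seq (vseq m)) :
  let g := fun y : vgroup m => \sum_(x <- s) h x * \1_(cylinder N x : set (vgroup m)) y in
  mu.-integrable setT (EFin \o g) /\
  (\int[mu]_y (g y)%:E = ((M N)%:R^-1 * \sum_(x <- s) h x)%:E)%E.
Proof.
elim: s => [|x s [IH1 IH2]] /=.
  have -> : (fun y : vgroup m => \sum_(x <- [::]) h x * \1_(cylinder N x : set (vgroup m)) y) = cst 0.
    by apply: funext => y; rewrite big_nil.
  split; last by rewrite integral0_eq ?big_nil ?mulr0// => y _; rewrite big_nil.
  exact: integrable0.
set g := fun y : vgroup m => \sum_(x <- s) h x * \1_(cylinder N x : set (vgroup m)) y.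
have E : (EFin \o (fun y : vgroup m => \sum_(x <- x :: s) h x * \1_(cylinder N x : set (vgroup m)) y)) =
    (fun y => (h x)%:E * (\1_(cylinder N x : set (vgroup m)) y)%:E + (g y)%:E)%E.
  by apply: funext => y; rewrite /= big_cons EFinD EFinM.
have i1 : mu.-integrable setT (fun y => (h x)%:E * (\1_(cylinder N x : set (vgroup m)) y)%:E)%E.
  by apply: integrableZl => //; apply: integrable_indic; exact: measurable_cylinder.
split; first by rewrite E; exact: integrableD.
have -> : (\int[mu]_y (\sum_(x0 <- x :: s) h x0 * \1_(cylinder N x0 : set (vgroup m)) y)%:E =
   \int[mu]_y ((h x)%:E * (\1_(cylinder N x : set (vgroup m)) y)%:E + (g y)%:E))%E.
  by apply: eq_integral => y _; rewrite big_cons EFinD EFinM.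
rewrite integralD// IH2 integralZl//; last first.
  by apply: integrable_indic; exact: measurable_cylinder.
rewrite integral_indic//; last exact: measurable_cylinder.
by rewrite setIT [X in (_ * X)%E](mu_cylinder N x) -EFinM -EFinD big_cons mulrDr mulrC.
Qed.

Lemma integrable_depends N (h : vgroup m -> R) : @depends_below m R N h ->
  mu.-integrable setT (EFin \o h).
Proof.
move=> hN; rewrite (sum_cylinders hN); exact: (integral_sum_cylinders N h _).1.
Qed.

Lemma integral_depends N (h : vgroup m -> R) : @depends_below m R N h ->
  (\int[mu]_y (h y)%:E = (avg N h)%:E)%E.
Proof.
move=> hN; have [_ <-] := integral_sum_cylinders N h (reps m N).
by apply: eq_integral => y _; rewrite {1}(sum_cylinders hN).
Qed.

Lemma depends_Re N (h : vseq m -> R[i]) : depends_below N h ->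
  depends_below N (fun x => complex.Re (h x)).
Proof. by move=> hN x y /hN ->. Qed.

Lemma depends_Im N (h : vseq m -> R[i]) : depends_below N h ->
  depends_below N (fun x => complex.Im (h x)).
Proof. by move=> hN x y /hN ->. Qed.

Definition saturated N (A : set (vgroup m)) := forall x y, agree N x y -> A x -> A y.

Lemma saturated_depends N (A : set (vgroup m)) : saturated N A ->
  @depends_below m bool N (fun x => `[< A x >]).
Proof. by move=> sA x y xy; apply/asboolP/asboolP; apply: sA => //; exact: agree_sym. Qed.

(** The sigma-algebra of order [N] is generated by a finite partition: its members are
    the unions of cylinders of order [N]. *)
Lemma vfiltration_saturated N A : vfiltration m N A <-> saturated N A.
Proof.
split.
  apply: (@smallest_sub _ _ _ [set A | saturated N A]) => [|_ [z _ <-] x y xy /= zx k kN].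
    split=> [x y _ []|A0 sA x y xy [_ nA]|F sF x y xy [n _ Fx]].
      split=> // Ay; apply: nA; apply: sA Ay; exact: agree_sym.
    by exists n => //; exact: sF xy Fx.
  by rewrite -xy// zx.
move=> sA; have -> : A = \bigcup_(x in [set` reps m N]) (if `[< A x >] then cylinder N x else set0).
  apply/seteqP; split=> [y Ay|y [x _]]; last first.
    by case: asboolP => // Ax yx; apply: sA Ax; apply: agree_sym.
  have := sum_reps_agree m2 y (fun (a b : vseq m) (_ : agree N a b) => erefl (1 : R)).
  have [[x [xr xy]]|no] := pselect (exists x, x \in reps m N /\ agree N x y).
    move=> _; exists x => //=; rewrite asboolT; last exact: sA (agree_sym xy) Ay.
    by move=> k kN; rewrite xy.
  rewrite big_seq big1 => [/esym/eqP|x xr]; first by rewrite oner_eq0.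
  by rewrite asboolF ?mulr0// => xy; apply: no; exists x.
rewrite bigcup_seq.
apply: (@bigsetU_measurable _ (g_sigma_algebraType [set cylinder N x | x in [set: vseq m]])).
move=> x _; case: ifP => _; last exact: measurable0.
by apply: sub_gen_smallest; exists x.
Qed.

Lemma measurable_saturated N (A : set (vgroup m)) : saturated N A -> measurable A.
Proof.
move=> /vfiltration_saturated; apply: smallest_sub => [|_ [x _ <-]].
  exact: sigma_algebra_measurable.
exact: measurable_cylinder.
Qed.

Lemma measurable_fun_depends N (h : vgroup m -> R) : @depends_below m R N h ->
  measurable_fun setT h.
Proof.
move=> hN _ Y mY; rewrite setTI; apply: (@measurable_saturated N) => x y xy.
by rewrite /preimage/= (hN x y).
Qed.

Lemma mu_saturated N (A : set (vgroup m)) : saturated N A ->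
  mu A = (avg N (fun x => (`[< A x >])%:R))%:E.
Proof.
move=> sA; have dA := saturated_depends sA.
rewrite -(@integral_depends N (fun x => (`[< A x >])%:R)); last first.
  by move=> x y xy; rewrite (dA x y xy).
rewrite (_ : mu A = \int[mu]_x (\1_A x)%:E)%E; last first.
  by rewrite integral_indic ?setIT//; exact: (measurable_saturated sA).
by apply: eq_integral => x _; rewrite indicE; congr ((nat_of_bool _)%:R%:E).
Qed.

Lemma Cmeasurable_depends N (h : vgroup m -> R[i]) :
  Cmeasurable_for (vfiltration m N) h <-> @depends_below m R[i] N h.
Proof.
split=> [mh x y xy|hN B mB].
  have [/vfiltration_saturated sR _] := mh [set complex.Re (h x)] (measurable_set1 _).
  have [_ /vfiltration_saturated sI] := mh [set complex.Im (h x)] (measurable_set1 _).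
  have := sR x y xy erefl; have := sI x y xy erefl => /=.
  by case: (h x) (h y) => a b [c d] /= -> ->.
by split; apply/vfiltration_saturated => x y xy /=; rewrite (hN _ _ xy).
Qed.

Lemma Cintegrable_depends N (h : vgroup m -> R[i]) : @depends_below m R[i] N h ->
  Cintegrable mu h.
Proof.
move=> hN; split; apply: (@integrable_depends N).
  exact: depends_Re.
exact: depends_Im.
Qed.

Lemma Rintegral_depends N A (h : vgroup m -> R) : saturated N A ->
  @depends_below m R N h ->
  (\int[mu]_(x in A) h x)%R = avg N (fun x => (`[< A x >])%:R * h x).
Proof.
move=> sA hN; rewrite /Rintegral integral_mkcond.
rewrite (_ : (\int[mu]_x _)%E = (\int[mu]_x ((`[< A x >])%:R * h x)%:E)%E); last first.
  apply: eq_integral => x _; rewrite patchE; case: asboolP => Ax.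
    by rewrite mem_set// mul1r.
  by rewrite memNset// mul0r.
rewrite (@integral_depends N)// => x y xy.
by rewrite (saturated_depends sA xy) (hN x y).
Qed.

Lemma avg_complex N (h : vseq m -> R[i]) :
  avg N h = (avg N (fun x => complex.Re (h x)) +i* avg N (fun x => complex.Im (h x)))%C.
Proof.
have P : forall (s : seq (vseq m)), \sum_(x <- s) h x =
    ((\sum_(x <- s) complex.Re (h x)) +i* (\sum_(x <- s) complex.Im (h x)))%C.
  elim=> [|x s IH]; first by rewrite !big_nil.
  by rewrite !big_cons IH; case: (h x).
rewrite /avg P -(rmorph_nat (real_complex R)) -fmorphV.
by rewrite mulrC; simpc; rewrite ![_ * (M N)%:R^-1]mulrC.
Qed.

Lemma Cintegral_depends N A (h : vgroup m -> R[i]) : saturated N A ->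
  @depends_below m R[i] N h ->
  Cintegral mu A h = avg N (fun x => (`[< A x >])%:R * h x).
Proof.
move=> sA hN; rewrite /Cintegral !(@Rintegral_depends N)//; [|exact: depends_Im|exact: depends_Re].
rewrite avg_complex; congr (_ +i* _)%C; apply: eq_avg => x.
  by case: asboolP => _; [rewrite !mul1r|rewrite !mul0r].
by case: asboolP => _; [rewrite !mul1r|rewrite !mul0r].
Qed.

Lemma avg_agree_mul N (h : vseq m -> R[i]) y : depends_below N h ->
  avg N (fun x => (`[< agree N x y >])%:R * h x) = (M N)%:R^-1 * h y.
Proof.
move=> hN; rewrite -[in RHS](sum_reps_agree m2 y hN); congr (_ * _).
by apply: eq_bigr => x _; rewrite mulrC.
Qed.

Lemma saturated_cylinder n x : saturated n (cylinder n x).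
Proof. by move=> y z yz yx k kn; rewrite -yz// yx. Qed.

Lemma saturatedT n : saturated n setT. Proof. by []. Qed.

Lemma saturated_leq n k A : (n <= k)%N -> saturated n A -> saturated k A.
Proof. by move=> nk sA x y xy; apply: sA; exact: agree_leq xy. Qed.

(** On the cylinders of order [n] the conditional expectation of [f n.+1] is its
    average over the coordinate [n]. *)
Lemma is_martingaleP f : is_martingale mu f <-> @discrete_martingale R m f.
Proof.
split=> [[mf _ cf]|[df af]].
  have df n : depends_below n (f n) by apply/Cmeasurable_depends.
  split=> // n x.
  have /vfiltration_saturated/(cf n n.+1 _ (leqnSn n)) := @saturated_cylinder n x.
  rewrite (Cintegral_depends (saturated_leq (leqnSn n) (@saturated_cylinder n x)))//.
  rewrite (Cintegral_depends (@saturated_cylinder n x))// avgS.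
  rewrite (_ : avg n (fun y => _ * f n y) = (M n)%:R^-1 * f n x); last first.
    exact: avg_agree_mul.
  rewrite (_ : avg n _ = (M n)%:R^-1 * coord_avg n (f n.+1) x).
    by move/mulfI; apply; rewrite invr_eq0 vbase_neq0.
  rewrite -avg_agree_mul; last exact: coord_avg_dependsS.
  apply: eq_avg => y; apply: (@coord_avgM _ _ (fun y => (`[< agree n y x >])%:R)) => z d.
  congr ((nat_of_bool _)%:R); apply/asboolP/asboolP => H.
    by apply: agree_trans H; apply: agree_sym; exact: agree_dfwith.
  exact: agree_trans (agree_dfwith _ _ _) H.
split=> [n|n|n k A nk]; first exact/Cmeasurable_depends.
  exact: Cintegrable_depends (df n).
move=> /vfiltration_saturated sA.
rewrite (Cintegral_depends (saturated_leq nk sA))// (Cintegral_depends sA)//.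
apply: (avg_martingale (conj df af)) => // x y xy.
by rewrite (saturated_depends sA xy).
Qed.

Section coefficients.
Variables (f : nat -> vseq m -> R[i]) (mf : discrete_martingale f).

Lemma vcoefE N i : (i < M N)%N ->
  vcoef mu f i = avg N (fun x => (vilenkin R i x)^* * f N x).
Proof.
move=> iN; apply: (@lim_near_cst R[i]^o); first exact: norm_hausdorff.
have dv k : (N <= k)%N -> @depends_below m R[i] k (fun x => (vilenkin R i x)^*).
  move=> Nk x y xy.
  by rewrite (@vilenkin_depends R m m2 _ _ (leq_vbase m2 Nk) _ iN x y xy).
exists N => // k /= Nk; rewrite (@Cintegral_depends k _ _ (@saturatedT k)); last first.
  by move=> x y xy; rewrite (mf.1 k x y xy) (dv k Nk x y xy).
rewrite -(avg_martingale mf (dv N (leqnn N)) Nk); apply: eq_avg => x.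
by rewrite asboolT// mul1r mulrC.
Qed.

Lemma psumE N n x : (n <= M N)%N ->
  psum mu f n x = avg N (fun t => f N t * dirichlet m (vroot R x t) n).
Proof.
move=> nN; rewrite /dirichlet; under eq_avg do rewrite mulr_sumr.
rewrite avg_sum; apply: eq_bigr => k _.
rewrite (vcoefE (leq_trans (ltn_ord k) nN)) mulrC -avgZ; apply: eq_avg => t.
by rewrite -vilenkinM; ring.
Qed.

Lemma sum_psumE N n x : (n <= M N)%N ->
  \sum_(k < n) psum mu f k x = fejer_sum f N n x.
Proof.
move=> nN; rewrite /fejer_sum /fejer; under eq_avg do rewrite mulr_sumr.
rewrite avg_sum; apply: eq_bigr => k _; apply: psumE.
exact: leq_trans (ltnW (ltn_ord k)) nN.
Qed.

Lemma psum_vbase N x : psum mu f (M N) x = f N x.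
Proof.
rewrite (@psumE N)//.
rewrite (_ : avg N _ = avg N (fun t => (M N)%:R * ((`[< agree N t x >])%:R * f N t))).
  by rewrite avgZ (avg_agree_mul x (mf.1 N)) mulrA divff ?mul1r ?vbase_neq0.
apply: eq_avg => t; rewrite dirichlet_vroot// (_ : `[< agree N x t >] = `[< agree N t x >]).
  by ring.
by apply/asboolP/asboolP; exact: agree_sym.
Qed.

End coefficients.

Lemma maximal_function_ge f n x : ((nrm (f n x))%:E <= maximal_function f x)%E.
Proof. by apply: ereal_sup_ubound; exists n. Qed.

Lemma maximal_function_ge0 f x : (0 <= maximal_function f x)%E.
Proof. by apply: le_trans (maximal_function_ge f 0 x); rewrite lee_fin normc_ge0. Qed.

Lemma measurable_maximal_function f : (forall n, @depends_below m R[i] n (f n)) ->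
  measurable_fun setT (maximal_function f).
Proof.
move=> df; pose F n (x : vgroup m) : \bar R := cabs (f n) x.
rewrite (_ : maximal_function f = fun x => esups (F ^~ x) 0%N); last first.
  apply: funext => x; rewrite /esups/=; congr ereal_sup.
  by apply/seteqP; split=> _ [n _ <-]; exists n.
apply: measurable_fun_esups => n.
apply/measurable_EFinP; apply: (@measurable_fun_depends n) => x y xy.
by rewrite (df n x y xy).
Qed.

End bridge.

(** * The maximal operator of the T means *)

Section abel.
Variables (R : realType) (q : nat -> R).
Hypothesis q_mono : nonincreasing_seq q.
Hypothesis q_ge0 : forall k, 0 <= q k.
Local Notation nrm := (@Normc.normc R).

Lemma QsumS n : Qsum q n.+1 = Qsum q n + q n.
Proof. by rewrite /Qsum big_ord_recr. Qed.

(** Summation by parts: non-increasing weights are positive combinations of the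
    weights of the Fejer means, so the T means inherit any bound of those. *)
Lemma abel_le (S : nat -> R[i]) Y n :
  (forall k, (k <= n)%N -> nrm (\sum_(j < k) S j) <= k%:R * Y) ->
  nrm (\sum_(k < n) (q k)%:C%C * S k) <= Qsum q n * Y.
Proof.
move=> HY; pose Phi k := \sum_(j < k) S j.
have H k : (k <= n)%N ->
    nrm (\sum_(j < k) (q j)%:C%C * S j - (q k)%:C%C * Phi k) <=
    (Qsum q k - k%:R * q k) * Y.
  elim: k => [_|k IH kn].
    by rewrite /Phi /Qsum !big_ord0 mulr0 subr0 mul0r subr0 mul0r Normc.normc0.
  have -> : \sum_(j < k.+1) (q j)%:C%C * S j - (q k.+1)%:C%C * Phi k.+1 =
      (\sum_(j < k) (q j)%:C%C * S j - (q k)%:C%C * Phi k) +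
      (q k - q k.+1)%:C%C * Phi k.+1.
    by rewrite /Phi !big_ord_recr/= rmorphB/=; ring.
  apply: le_trans (le_normcD _ _) _.
  rewrite [leRHS](_ : _ = (Qsum q k - k%:R * q k) * Y +
      (q k - q k.+1) * (k.+1%:R * Y)); last by rewrite QsumS -natr1; ring.
  rewrite lerD ?IH ?(ltnW kn)// Normc.normcM normc_real ger0_norm; last first.
    by rewrite subr_ge0 q_mono.
  by rewrite ler_wpM2l ?HY// subr_ge0 q_mono.
rewrite -[X in nrm X](subrK ((q n)%:C%C * Phi n)).
apply: le_trans (le_normcD _ _) _.
rewrite [leRHS](_ : _ = (Qsum q n - n%:R * q n) * Y + q n * (n%:R * Y)); last by ring.
by rewrite lerD ?H// Normc.normcM normc_real ger0_norm// ler_wpM2l// HY.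
Qed.

End abel.

Section maximal_operator.
Variables (R : realType) (m : nat -> nat) (m2 : forall k, (2 <= m k)%N).
Variables (mu : probability (vgroup m) R) (hmu : is_product_measure mu).
Variables (f : nat -> vgroup m -> R[i]) (mf : @discrete_martingale R m f).
Variable q : nat -> R.
Hypothesis q_mono : nonincreasing_seq q.
Hypothesis q_ge0 : forall k, 0 <= q k.
Hypothesis q0_gt0 : 0 < q 0%N.
Implicit Types (x y : vseq m).
Local Notation nrm := (@Normc.normc R).
Local Notation M := (vbase m).

Lemma Qsum_gt0 n : (0 < n)%N -> 0 < Qsum q n.
Proof.
case: n => // n _; rewrite /Qsum big_ord_recl ltr_pwDl//.
by apply: sumr_ge0 => i _.
Qed.

Lemma psum_depends n N : (n <= M N)%N -> @depends_below m R[i] N (psum mu f n).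
Proof.
move=> nN x y xy; apply: eq_bigr => k _.
by rewrite (@vilenkin_depends R m m2 n N nN k (ltn_ord k) x y xy).
Qed.

Lemma sum_psum_depends (c : nat -> R[i]) n N : (n <= M N)%N ->
  @depends_below m R[i] N (fun x => \sum_(k < n) c k * psum mu f k x).
Proof.
move=> nN x y xy; apply: eq_bigr => k _.
by rewrite (@psum_depends k N _ x y)// (leq_trans (ltnW (ltn_ord k))).
Qed.

Lemma Tmean_depends n N : (n <= M N)%N -> @depends_below m R[i] N (Tmean mu q f n).
Proof.
move=> nN x y xy.
exact: (congr1 (fun z => ((Qsum q n)^-1)%:C%C * z)
  (sum_psum_depends (fun k => (q k)%:C%C) nN xy)).
Qed.

Definition large_fejer (l : R) K : set (vgroup m) :=
  [set x | exists n, [/\ (0 < n)%N, (n <= M K.+1)%N &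
    n%:R * l < nrm (\sum_(k < n) psum mu f k x)]].

Lemma large_fejer_saturated l K : saturated K.+1 (large_fejer l K).
Proof.
move=> x y xy [n [n0 nK H]]; exists n; split; [exact: n0|exact: nK|].
suff <- : \sum_(k < n) psum mu f k x = \sum_(k < n) psum mu f k y by exact: H.
apply: eq_bigr => k _; apply: (@psum_depends k K.+1 _ x y xy).
by rewrite (leq_trans (ltnW (ltn_ord k))).
Qed.

Lemma large_fejer_sub l x n : (0 < n)%N -> l < nrm (Tmean mu q f n x) ->
  exists K, large_fejer l K x.
Proof.
move=> n0 lT; have [//|no] := pselect (exists K, large_fejer l K x).
exfalso; move: lT; apply/negP; rewrite -leNgt.
rewrite /Tmean Normc.normcM normc_real ger0_norm ?invr_ge0 ?(ltW (Qsum_gt0 n0))//.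
rewrite ler_pdivrMl ?Qsum_gt0//; apply: (@abel_le R q q_mono q_ge0 (fun k => psum mu f k x)) => k kn.
rewrite leNgt; apply/negP => H; apply: no; exists n, k; split; [ | |exact: H].
  case: k H {kn} => // H; move: H.
  by rewrite mul0r big_ord0 Normc.normc0 ltxx.
by rewrite (leq_trans kn)// ltnW// (leq_trans (vbase_gt n m2))// leq_vbase.
Qed.

Lemma measurable_Tmaximal_gt (l : R) : 0 < l ->
  [set x | (l%:E < `|Tmaximal mu q f x|)%E] =
  \bigcup_(n in [set n | (0 < n)%N]) [set x | l < nrm (Tmean mu q f n x)] /\
  measurable [set x | (l%:E < `|Tmaximal mu q f x|)%E].
Proof.
move=> l0.
have T0 x : (0 <= Tmaximal mu q f x)%E.
  apply: (@le_trans _ _ (cabs (Tmean mu q f 1) x)); last first.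
    by apply: ereal_sup_ubound; exists 1%N.
  by rewrite lee_fin normc_ge0.
have E : [set x | (l%:E < `|Tmaximal mu q f x|)%E] =
  \bigcup_(n in [set n | (0 < n)%N]) [set x | l < nrm (Tmean mu q f n x)].
  apply/seteqP; split=> x /=; rewrite gee0_abs//.
    by move=> /ereal_sup_gt[_ [n n0 <-]] lT; exists n.
  move=> [n n0 lT]; apply: (@lt_le_trans _ _ (cabs (Tmean mu q f n) x)).
    by rewrite lte_fin.
  by apply: ereal_sup_ubound; exists n.
split=> //; rewrite E; apply: bigcup_measurable => n _.
apply: (measurable_saturated R m2 (N := n)) => x y xy /=.
by rewrite (@Tmean_depends n n _ x y)// ltnW// vbase_gt.
Qed.

Lemma avg_sqrt_max_le K :
  ((avg K (fun x => Num.sqrt (max_upto f K x)))%:E <=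
   \int[mu]_x (`|maximal_function f x| `^ 2^-1))%E.
Proof.
have dmax : @depends_below m R K (fun x => Num.sqrt (max_upto f K x)).
  move=> x y xy; congr Num.sqrt; apply: eq_bigr => j _; congr nrm.
  by apply: mf.1; apply: agree_leq xy; rewrite -ltnS.
have mmax : measurable_fun [set: vgroup m] (fun x => (Num.sqrt (max_upto f K x))%:E).
  by apply/measurable_EFinP; exact (measurable_fun_depends m2 dmax).
rewrite -(integral_depends m2 hmu dmax); apply: ge0_le_integral => //.
  apply: (@measurableT_comp _ _ _ _ _ _ (fun x : \bar R => (x `^ 2^-1)%E)).
    exact: measurable_poweR.
  apply: measurableT_comp => //; apply: (measurable_maximal_function m2).
  exact: mf.1.
move=> x _; rewrite gee0_abs ?maximal_function_ge0// -powR12_sqrt ?max_upto_ge0//.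
rewrite -poweR_EFin; apply: gt0_ler_poweR.
- by rewrite invr_ge0.
- by rewrite in_itv/= lee_fin max_upto_ge0 leey.
- by rewrite in_itv/= maximal_function_ge0 leey.
have := maximal_function_ge0 f x; have := maximal_function_ge f ^~ x.
case: (maximal_function f x) => [r|_ _|//]; last exact: leey.
move=> H r0; rewrite lee_fin; apply/bigmax_leP; split=> [|j _]; first by rewrite -lee_fin.
by rewrite -lee_fin.
Qed.

Variables (B : nat) (mB : forall k, (m k <= B)%N).

Lemma mu_Tmaximal_gt_le (l : R) : 0 < l ->
  (mu [set x | (l%:E < `|Tmaximal mu q f x|)%E] <=
   (weak_cst R B / Num.sqrt l)%:E *
   \int[mu]_x (`|maximal_function f x| `^ 2^-1))%E.
Proof.
move=> l0; set J := (\int[mu]_x _)%E.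
have [E mT] := measurable_Tmaximal_gt l0.
have mW K : measurable (large_fejer l K).
  exact: (measurable_saturated R m2 (@large_fejer_saturated l K)).
have mUW : measurable (\bigcup_K large_fejer l K) by exact: bigcup_measurable.
apply: (@le_trans _ _ (mu (\bigcup_K large_fejer l K))).
  apply: le_measure; rewrite ?inE// E => x [n n0 lT].
  by have [K xK] := large_fejer_sub n0 lT; exists K.
have cv : (mu \o large_fejer l) @ \oo --> mu (\bigcup_K large_fejer l K).
  apply: nondecreasing_cvg_mu => // K K' KK'; apply/subsetPset => x [n [n0 nK H]].
  by exists n; split; [exact: n0|rewrite (leq_trans nK)// leq_vbase|exact: H].
rewrite -(cvg_lim _ cv)//; apply: lime_le; first by apply/cvg_ex; eexists; exact: cv.
apply: nearW => K /=.
rewrite (mu_saturated m2 hmu (@large_fejer_saturated l K)).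
have w0 : (0 <= (weak_cst R B / Num.sqrt l)%:E)%E.
  by rewrite lee_fin divr_ge0 ?sqrtr_ge0// weak_cst_ge0.
apply: le_trans (lee_wpmul2l w0 (avg_sqrt_max_le K.+1)).
rewrite -EFinM lee_fin.
apply: le_trans (weak_type_fejer m2 mB mf K l0).
apply: le_avg => x; rewrite ler_nat leq_eqVlt; apply/orP; left; apply/eqP.
congr nat_of_bool; apply/asboolP/asboolP => -[n [n0 nK H]]; exists n.
  by split; [exact: n0|exact: nK|rewrite -(sum_psumE m2 hmu mf x nK); exact: H].
by split; [exact: n0|exact: nK|rewrite (sum_psumE m2 hmu mf x nK); exact: H].
Qed.

(** The exponent [(2^-1)^-1] is [2], so both sides are squares and only the weak type
    bound of the distribution function is left. *)
Lemma weak_type_Tmaximal :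
  (weakLnorm mu 2^-1 (Tmaximal mu q f) <=
   (weak_cst R B `^ (2^-1)^-1)%:E * Hnorm mu 2^-1 f)%E.
Proof.
rewrite /weakLnorm /Hnorm unlock -poweR_EFin -poweRM; last 2 first.
- by rewrite lee_fin weak_cst_ge0.
- by apply: integral_ge0 => x _; exact: poweR_ge0.
have J0 : (0 <= \int[mu]_x (`|maximal_function f x| `^ 2^-1))%E.
  by apply: integral_ge0 => x _; exact: poweR_ge0.
have w0 : 0 <= weak_cst R B by exact: weak_cst_ge0.
have wJ0 : (0 <= (weak_cst R B)%:E * \int[mu]_x (`|maximal_function f x| `^ 2^-1))%E.
  by rewrite mule_ge0.
have sup_le : (ereal_sup [set (l `^ 2^-1)%:E * mu [set x | l%:E < `|Tmaximal mu q f x|]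
    | l in `]0%R, +oo[%classic] <=
    (weak_cst R B)%:E * \int[mu]_x (`|maximal_function f x| `^ 2^-1))%E.
  apply: ub_ereal_sup => _ [l lI <-].
  have l0 : 0 < l by move: lI; rewrite /= in_itv/= andbT.
  rewrite powR12_sqrt ?(ltW l0)//.
  apply: le_trans (lee_wpmul2l _ (mu_Tmaximal_gt_le l0)) _.
    by rewrite lee_fin sqrtr_ge0.
  by rewrite muleA -EFinM mulrCA divff ?mulr1// gt_eqF// sqrtr_gt0.
have sup0 : (0 <= ereal_sup [set (l `^ 2^-1)%:E * mu [set x | l%:E < `|Tmaximal mu q f x|]
    | l in `]0%R, +oo[%classic])%E.
  apply: (@le_trans _ _ ((1 `^ 2^-1)%:E * mu [set x | (1%:E < `|Tmaximal mu q f x|)%E])%E).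
    by rewrite mule_ge0// lee_fin powR_ge0.
  by apply: ereal_sup_ubound; exists 1; rewrite //= in_itv/= ltr01.
apply: gt0_ler_poweR => //.
- by rewrite in_itv/= sup0 leey.
- by rewrite in_itv/= wJ0 leey.
Qed.

End maximal_operator.

(** * A martingale in [H_p] with unbounded T means *)

(** The shares of [a] and [b] in [a + b] are at most their [p]-th powers. *)
Lemma powRD_le (R : realType) (p a b : R) : 0 < p -> p <= 1 -> 0 <= a -> 0 <= b ->
  (a + b) `^ p <= a `^ p + b `^ p.
Proof.
move=> p0 p1 a0 b0; have [ab0|ab0] := eqVneq (a + b) 0.
  by rewrite ab0 powR0 ?gt_eqF// addr_ge0 ?powR_ge0.
have ab : 0 < a + b by rewrite lt_def ab0 addr_ge0.
have share c : 0 <= c -> c <= a + b -> (a + b) `^ p * (c / (a + b)) <= c `^ p.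
  rewrite le_eqVlt => /predU1P[<- _|c0 cab]; first by rewrite mul0r mulr0 powR_ge0.
  have -> : c `^ p = (a + b) `^ p * (c / (a + b)) `^ p.
    by rewrite -powRM ?divr_ge0 ?(ltW ab) ?(ltW c0)// mulrC divfK.
  rewrite ler_wpM2l ?powR_ge0// ger1_powR// divr_gt0//= ler_pdivrMr// mul1r.
  exact: cab.
have := lerD (share a a0 _) (share b b0 _); rewrite lerDl lerDr => /(_ b0 a0).
by rewrite -mulrDr -mulrDl divff// mulr1.
Qed.

Lemma powR_sum_le (R : realType) (p : R) (u : nat -> R) n : 0 < p -> p <= 1 ->
  (forall i, 0 <= u i) -> (\sum_(i < n) u i) `^ p <= \sum_(i < n) u i `^ p.
Proof.
move=> p0 p1 u0; elim: n => [|n IH]; first by rewrite !big_ord0 powR0// gt_eqF.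
rewrite !big_ord_recr/=; apply: le_trans (powRD_le p0 p1 _ (u0 n)) _.
  by apply: sumr_ge0.
by rewrite lerD2r.
Qed.

Lemma exprn_powR (R : realType) (p x y : R) n : 0 <= x -> x `^ p = y ->
  (x ^+ n) `^ p = y ^+ n.
Proof. by move=> x0 <-; rewrite -powR_mulrn// powRAC powR_mulrn ?powR_ge0. Qed.

Section counterexample.
Variables (R : realType) (m : nat -> nat) (m2 : forall k, (2 <= m k)%N).
Variables (mu : probability (vgroup m) R) (hmu : is_product_measure mu).
Variables (p : R) (p_gt0 : 0 < p) (p_lt : p < 2^-1).
Implicit Types (x y : vseq m).
Local Notation nrm := (@Normc.normc R).
Local Notation M := (vbase m).

Let e : R := 1 - 2 * p.
Let t : R := 2 `^ (e / 2).

(** The [p]-th power [t] of this ratio is smaller than [t ^ 2 = 2 ^ (1 - 2 p)], the rate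
    at which [M a ^ (2 p - 1)] decreases at least. *)
Definition growth_ratio : R := t `^ p^-1.
Local Notation s := growth_ratio.

Let e_gt0 : 0 < e.
Proof. by rewrite /e; move: p_lt; lra. Qed.

Let t_gt1 : 1 < t.
Proof.
rewrite /t -[ltLHS](powRr0 2) /powR pnatr_eq0/= ltr_expR mul0r.
by rewrite mulr_gt0 ?divr_gt0// ln_gt0// ltr1n.
Qed.

Let t_gt0 : 0 < t. Proof. exact: lt_trans t_gt1. Qed.

Lemma growth_ratio_gt1 : 1 < s.
Proof.
rewrite -[ltLHS](_ : 1 `^ p^-1 = 1); last by rewrite powR1.
by apply: gt0_ltr_powR; rewrite ?invr_gt0// nnegrE// ltW.
Qed.

Let s_gt0 : 0 < s. Proof. exact: lt_trans growth_ratio_gt1. Qed.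

Let sp : s `^ p = t.
Proof. by rewrite /s -powRrM mulVf ?gt_eqF// powRr1// ltW. Qed.

(** The height on the cylinder of order [a] of the increment with coefficient
    [M a * s ^ a]; the coefficients have to grow faster than [M a]. *)
Definition spike (a : nat) : R := (M a)%:R ^+ 2 * s ^+ a.

Let M_gt0 a : 0 < (M a)%:R :> R. Proof. by rewrite ltr0n vbase_gt0. Qed.

Lemma spike_ge0 a : 0 <= spike a.
Proof. by rewrite mulr_ge0 ?exprn_ge0// ltW. Qed.

Lemma spike_powR a : spike a `^ p / (M a)%:R <= t^-1 ^+ a.
Proof.
have M0 := M_gt0 a.
have -> : spike a `^ p = (M a)%:R / (M a)%:R `^ e * t ^+ a.
  rewrite /spike powRM ?exprn_ge0 ?(ltW s_gt0)//; congr (_ * _).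
    rewrite -powR_mulrn// -powRrM (_ : 2%:R * p = 1 - e); last by rewrite /e; ring.
    by rewrite powRB ?(gt_eqF M0) ?implybT// powRr1// ltW.
  exact: exprn_powR (ltW s_gt0) sp.
have Me : t ^+ a * t ^+ a <= (M a)%:R `^ e.
  rewrite -exprMn (_ : t * t = 2 `^ e); last first.
    by rewrite -powRD ?pnatr_eq0 ?implybT//; congr (_ `^ _); field.
  have M2 : 2 ^+ a <= (M a)%:R :> R.
    elim: a {M0} => [|b IH]; first by rewrite expr0 ler1n vbase_gt0.
    by rewrite exprS (le_trans _ (vbase_double R m2 b))// ler_pM2l.
  rewrite -(powR_mulrn a (powR_ge0 2 e)) powRAC (powR_mulrn a (ler0n R 2)).
  apply: ge0_ler_powR; [exact: ltW|by rewrite nnegrE exprn_ge0| |exact: M2].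
  by rewrite nnegrE ler0n.
have ta : 0 < t ^+ a by exact: exprn_gt0.
rewrite exprVn -[leRHS]mul1r ler_pdivlMr// -!mulrA mulrCA.
rewrite (_ : _ * _ = t ^+ a * t ^+ a / (M a)%:R `^ e); last first.
  by field; rewrite !gt_eqF// powR_gt0.
by rewrite ler_pdivrMr ?powR_gt0// mul1r.
Qed.

Definition origin : vseq m := fun=> 0.

Definition spikes n x : R[i] :=
  \sum_(a < n) (spike a * (`[< agree a x origin >])%:R)%:C%C * rademacher R a (x : vgroup m).

Let spikesS n x : spikes n.+1 x = spikes n x +
  (spike n * (`[< agree n x origin >])%:R)%:C%C * rademacher R n x.
Proof. by rewrite /spikes big_ord_recr. Qed.

Lemma spikes_martingale : discrete_martingale spikes.
Proof.
have indic_dep n : depends_below n (fun x =>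
    (spike n * (`[< agree n x origin >])%:R)%:C%C).
  move=> x y xy; congr (_ * (nat_of_bool _)%:R)%:C%C; apply/asboolP/asboolP => H.
    exact: agree_trans (agree_sym xy) H.
  exact: agree_trans xy H.
have dep n : depends_below n (spikes n).
  move=> x y xy; apply: eq_bigr => a _.
  rewrite (indic_dep a x y (agree_leq (ltnW (ltn_ord a)) xy)).
  by rewrite (@rademacher_depends R m a x y (agree_leq (ltn_ord a) xy)).
split=> // n x; rewrite (eq_coord_avg _ _ (spikesS n)) coord_avgD.
rewrite (coord_avg_id m2) => [|y d]; last exact: depends_dfwith (dep n) (leqnn n).
rewrite coord_avgM ?coord_avg_rademacher ?mulr0 ?addr0// => y d.
exact: depends_dfwith (indic_dep n) (leqnn n).
Qed.

Lemma vcoef_spikes a : vcoef mu spikes (M a) = ((M a)%:R * s ^+ a)%:C%C.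
Proof.
have dm := spikes_martingale.
rewrite (@vcoefE R m m2 mu hmu spikes dm a.+1); last first.
  by rewrite vbaseS ltn_Pmulr// vbase_gt0.
rewrite avgS (_ : avg a _ = avg a (fun x => (spike a)%:C%C * ((`[< agree a x origin >])%:R))).
  rewrite avgZ avg_agree// -(rmorph_nat (real_complex R)) -fmorphV -rmorphM/=.
  by congr (_%:C)%C; rewrite /spike; field; rewrite gt_eqF.
apply: eq_avg => x.
transitivity (coord_avg a (fun y => spikes a y * (rademacher R a (y : vgroup m))^* +
    (spike a * (`[< agree a y origin >])%:R)%:C%C) x).
  apply: eq_coord_avg => y; rewrite vilenkin_vbase// spikesS mulrDr mulrC; congr (_ + _).
  by rewrite mulrC -mulrA -/(vroot R y y a) vroot_eq1// mulr1.
rewrite coord_avgD coord_avgM => [|y d]; last exact: depends_dfwith (dm.1 a) (leqnn a).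
rewrite coord_avg_rademacherJ// mulr0 add0r.
rewrite (coord_avg_id m2) => [|y d].
  by rewrite rmorphM rmorph_nat.
congr (_ * (nat_of_bool _)%:R)%:C%C; apply/asboolP/asboolP => H.
  by apply: agree_trans H; apply: agree_sym; exact: agree_dfwith.
exact: agree_trans (agree_dfwith _ _ _) H.
Qed.

(** Off the cylinder of order [1] of the origin the lower partial sums stay bounded,
    so a single new coefficient is visible on a set of measure at least [1 / 2]. *)
Lemma psum_spikes_ge a x : x 0%N <> 0 -> (0 < a)%N ->
  (M a)%:R * s ^+ a - 1 <= nrm (psum mu spikes (M a).+1 x).
Proof.
move=> x0 a0; rewrite /psum big_ord_recr/= -/(psum mu spikes (M a) x).
rewrite (psum_vbase m2 hmu spikes_martingale) vcoef_spikes.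
have -> : spikes a x = rademacher R 0%N (x : vgroup m).
  case: a a0 => // a _; rewrite /spikes big_ord_recl big1 ?addr0 => [|i _].
    rewrite asboolT ?mulr1; last by move=> k.
    by rewrite /spike vbase0 expr1n expr0 mulr1 mul1r.
  rewrite asboolF ?mulr0 ?mul0r// => H; apply: x0.
  by rewrite (H 0%N).
rewrite lerBlDr; set z := (X in nrm (_ + X)); set r := rademacher R 0 x.
have -> : (M a)%:R * s ^+ a = nrm z.
  rewrite /z Normc.normcM normc_vilenkin mulr1 normc_real ger0_norm//.
  by rewrite mulr_ge0// exprn_ge0// ltW.
rewrite -(_ : nrm r = 1); last exact: normc_rademacher.
by apply: le_trans (normcB (r + z) r); rewrite [r + z]addrC addrK.
Qed.

Lemma Hnorm_spikes_lt : (Hnorm mu p spikes < +oo)%E.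
Proof.
have dm := spikes_martingale.
have p1 : p <= 1 by rewrite (le_trans (ltW p_lt))// invf_le1// ler1n.
pose u a x : R := spike a `^ p * (`[< agree a x origin >])%:R.
have u0 a x : 0 <= u a x by rewrite mulr_ge0 ?powR_ge0.
have ud a : @depends_below m R a (u a).
  move=> x y xy; congr (_ * (nat_of_bool _)%:R); apply/asboolP/asboolP => H.
    exact: agree_trans (agree_sym xy) H.
  exact: agree_trans xy H.
have um a : measurable_fun [set: vgroup m] (EFin \o u a).
  by apply/measurable_EFinP; exact (measurable_fun_depends m2 (ud a)).
pose S x := (\sum_(0 <= a <oo) (u a x)%:E)%E.
have S0 x : (0 <= S x)%E by apply: nneseries_ge0 => a _ _; rewrite lee_fin.
have fS x : (maximal_function spikes x `^ p <= S x)%E.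
  have /le_trans -> // : (maximal_function spikes x `^ p <= (S x `^ p^-1) `^ p)%E.
    apply: gt0_ler_poweR; first exact: ltW.
    - by rewrite in_itv/= maximal_function_ge0 leey.
    - by rewrite in_itv/= poweR_ge0 leey.
    apply: ub_ereal_sup => _ [n _ <-].
    rewrite (_ : cabs (spikes n) x = (((nrm (spikes n x) `^ p)%:E) `^ p^-1)%E); last first.
      by rewrite poweR_EFin -powRrM divff ?gt_eqF// powRr1// normc_ge0.
    apply: gt0_ler_poweR; first by rewrite invr_ge0 ltW.
    - by rewrite in_itv/= lee_fin powR_ge0 leey.
    - by rewrite in_itv/= S0 leey.
    apply: (@le_trans _ _ (\sum_(0 <= a < n) (u a x)%:E)%E); last first.
      by apply: nneseries_lim_ge => a _; rewrite lee_fin.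
    rewrite sumEFin lee_fin big_mkord.
    apply: (@le_trans _ _ ((\sum_(a < n) spike a * (`[< agree a x origin >])%:R) `^ p)).
      apply: ge0_ler_powR; rewrite ?nnegrE ?normc_ge0 ?(ltW p_gt0)//.
        by apply: sumr_ge0 => a _; rewrite mulr_ge0// spike_ge0.
      apply: le_trans (normc_sum _ _ _) _; apply: ler_sum => a _.
      rewrite Normc.normcM normc_rademacher mulr1 normc_real ger0_norm//.
      by rewrite mulr_ge0// spike_ge0.
    apply: le_trans (@powR_sum_le _ p (fun a => spike a * (`[< agree a x origin >])%:R) n p_gt0 p1 _) _.
      by move=> a; rewrite mulr_ge0// spike_ge0.
    apply: ler_sum => a _; rewrite /u; case: asboolP => _; first by rewrite !mulr1.
    by rewrite !mulr0 powR0// gt_eqF.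
  by rewrite -poweRrM mulVf ?gt_eqF// poweRe1.
have mS : measurable_fun [set: vgroup m] S.
  by apply: ge0_emeasurable_sum => [a x _ _|a _]; [rewrite lee_fin|exact (um a)].
rewrite /Hnorm unlock; apply: poweR_lty.
apply: (@le_lt_trans _ _ (\int[mu]_x S x)%E).
  apply: ge0_le_integral => //.
  - by move=> x _; exact: poweR_ge0.
  - apply: (@measurableT_comp _ _ _ _ _ _ (fun x : \bar R => (x `^ p)%E)).
      exact: measurable_poweR.
    apply: measurableT_comp => //; apply: (measurable_maximal_function m2).
    exact: dm.1.
  by move=> x _; rewrite gee0_abs ?maximal_function_ge0.
rewrite integral_nneseries//; last by move=> a x _; rewrite lee_fin.
apply: (@le_lt_trans _ _ ((1 - t^-1)^-1)%:E); last exact: ltey.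
apply: lime_le.
  by apply: is_cvg_nneseries => a _ _; apply: integral_ge0 => x _; rewrite lee_fin.
apply: nearW => n.
apply: (@le_trans _ _ (\sum_(0 <= a < n) (t^-1 ^+ a)%:E)%E).
  apply: lee_sum => a _; rewrite (integral_depends m2 hmu (ud a)) lee_fin.
  by rewrite /u avgZ avg_agree// spike_powR.
rewrite sumEFin lee_fin big_mkord sum_geometric_le//.
  by rewrite invr_ge0 ltW.
by rewrite invf_lt1.
Qed.

Lemma spikes_hardy : hardy mu p spikes.
Proof.
split; last exact: Hnorm_spikes_lt.
by apply/(is_martingaleP m2 hmu); exact: spikes_martingale.
Qed.

Lemma mu_off_cylinder : ((2^-1)%:E <= mu (~` cylinder 1 origin))%E.
Proof.
rewrite probability_setC; last exact: measurable_cylinder.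
rewrite (mu_cylinder hmu) -EFinB lee_fin.
have : (M 1)%:R^-1 <= 2^-1 :> R.
  by rewrite lef_pV2 ?posrE// ler_nat vbaseS vbase0 mul1n.
lra.
Qed.

Variable q : nat -> R.
Hypothesis q_ge0 : forall k, 0 <= q k.
Hypothesis q0_gt0 : 0 < q 0%N.

(** The sums that define two consecutive T means differ by [q n.+1] times the partial
    sum of index [n.+1]. *)
Lemma psum_le_Tmean f n x l :
  nrm (Tmean mu q f n.+2 x) <= l -> nrm (Tmean mu q f n.+1 x) <= l ->
  q n.+1 / Qsum q n.+2 * nrm (psum mu f n.+1 x) <= 2 * l.
Proof.
move=> T2 T1; have Q1 : 0 < Qsum q n.+1 by exact: Qsum_gt0.
have Q2 : 0 < Qsum q n.+2 by exact: Qsum_gt0.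
have l0 : 0 <= l by exact: le_trans (normc_ge0 _) T1.
have QT k : 0 < Qsum q k -> (Qsum q k)%:C%C * Tmean mu q f k x =
    \sum_(j < k) (q j)%:C%C * psum mu f j x.
  move=> Qk; rewrite /Tmean mulrA -rmorphM divff ?gt_eqF// mul1r; exact: erefl.
have E : (q n.+1)%:C%C * psum mu f n.+1 x =
    (Qsum q n.+2)%:C%C * Tmean mu q f n.+2 x - (Qsum q n.+1)%:C%C * Tmean mu q f n.+1 x.
  by rewrite !QT// [X in _ = X - _]big_ord_recr/= [RHS]addrAC subrr add0r.
move: (Tmean mu q f n.+2 x) (Tmean mu q f n.+1 x) T2 T1 E => z2 z1 T2 T1 E.
have H : q n.+1 * nrm (psum mu f n.+1 x) <= Qsum q n.+2 * (2 * l).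
  rewrite -{1}(ger0_norm (q_ge0 n.+1)) -normc_real -Normc.normcM E.
  apply: le_trans (normcB _ _) _; rewrite !Normc.normcM !normc_real !gtr0_norm//.
  rewrite [leRHS](_ : _ = Qsum q n.+2 * l + Qsum q n.+2 * l); last by ring.
  apply: lerD; first by rewrite ler_pM2l.
  by apply: ler_pM; rewrite ?normc_ge0 ?(ltW Q1)// [leRHS]QsumS lerDl.
by rewrite mulrAC ler_pdivrMr// [leRHS]mulrC.
Qed.

Lemma Tmean_large (W : R) n : 0 <= W -> (0 < n)%N ->
  (weakLnorm mu p (cabs (Tmean mu q spikes n)) <= W%:E)%E ->
  forall l, 0 < l ->
  ((l `^ p)%:E * mu [set x | (l < nrm (Tmean mu q spikes n x))%R] <= (W `^ p)%:E)%E.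
Proof.
move=> W0 n0; rewrite /weakLnorm; set S := ereal_sup _ => SW l l0.
have lS : ((l `^ p)%:E * mu [set x | (l < nrm (Tmean mu q spikes n x))%R] <= S)%E.
  apply: ereal_sup_ubound; exists l; first by rewrite /= in_itv/= l0.
  by congr (_ * mu _)%E; apply/seteqP; split=> x /=; rewrite lte_fin ger0_norm ?normc_ge0.
apply: (le_trans lS).
have S0 : (0 <= S)%E by apply: le_trans lS; rewrite mule_ge0// lee_fin powR_ge0.
have : ((S `^ p^-1) `^ p <= (W%:E) `^ p)%E.
  apply: gt0_ler_poweR; rewrite ?(ltW p_gt0)//.
  - by rewrite in_itv/= poweR_ge0 leey.
  - by rewrite in_itv/= lee_fin W0 leey.
by rewrite -poweRrM mulVf ?gt_eqF// poweRe1.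
Qed.

(** If the weak norms were bounded, then every two consecutive T means would be at most
    some [l], independent of the index, at a common point outside the cylinder of
    order [1] of the origin, which contradicts [psum_spikes_ge] and
    [psum_le_Tmean]. *)
Lemma unbounded_Tmeans (c : R) : 0 < c ->
  (forall n : nat, (0 < n)%N -> c / n%:R <= q n.+1 / Qsum q n.+2) ->
  ereal_sup [set weakLnorm mu p (cabs (Tmean mu q spikes n))
            | n in [set n | (0 < n)%N]] = +oo%E.
Proof.
move=> c0 qc; apply/eqP; rewrite -leye_eq leNgt; apply/negP => supW.
set sup := ereal_sup _ in supW.
have sup_ge n : (0 < n)%N -> (weakLnorm mu p (cabs (Tmean mu q spikes n)) <= sup)%E.
  by move=> n0; apply: ereal_sup_ubound; exists n.
have sup0 : (0 <= sup)%E.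
  by apply: le_trans (sup_ge 1%N _) => //; exact: poweR_ge0.
have [W W0 WE] : exists2 W : R, 0 <= W & sup = W%:E.
  by case: sup sup0 supW {sup_ge} => [r|//|//] r0 _; exists r; rewrite -?lee_fin.
rewrite WE in sup_ge.
pose l := (4 * W `^ p + 1) `^ p^-1.
have w0 : 0 <= W `^ p by exact: powR_ge0.
have l0 : 0 < l by rewrite powR_gt0//; lra.
have lp : l `^ p = 4 * W `^ p + 1.
  by rewrite /l -powRrM mulVf ?gt_eqF// powRr1//; lra.
pose A n := [set x : vgroup m | l < nrm (Tmean mu q spikes n x)].
have dT n : @depends_below m R[i] n (Tmean mu q spikes n).
  by apply: (Tmean_depends m2); rewrite ltnW// vbase_gt.
have mA n : measurable (A n).
  by apply: (measurable_saturated R m2 (N := n)) => x y xy /=; rewrite /A/= (dT n x y xy).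
have muA n : (0 < n)%N -> (mu (A n) < (4^-1)%:E)%E.
  move=> n0; have key : ((l `^ p)%:E * mu (A n) <= (W `^ p)%:E)%E.
    exact: (Tmean_large W0 n0 (sup_ge n n0) l0).
  have r0 : (0 <= mu (A n))%E by exact: measure_ge0.
  have fin : (mu (A n) \is a fin_num)%E by exact: fin_num_measure.
  move: key r0 fin; case: (mu (A n)) => [r|//|//].
  by rewrite -EFinM !lee_fin lte_fin lp => h r0 _; nra.
have small a : exists x : vseq m, [/\ x 0%N <> 0, ~ A (M a).+2 x & ~ A (M a).+1 x].
  apply: contrapT => no.
  have : (mu (~` cylinder 1 origin) <= mu (A (M a).+2 `|` A (M a).+1))%E.
    apply: le_measure; rewrite ?inE.
    - by apply: measurableC; exact: measurable_cylinder.
    - exact: measurableU.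
    move=> x xc; apply: contrapT => nA; apply: no; exists x; split.
    - by move=> x0; apply: xc => -[].
    - by move=> Ax; apply: nA; left.
    - by move=> Ax; apply: nA; right.
  apply/negP; rewrite -ltNge; apply: lt_le_trans mu_off_cylinder.
  have subadd : (mu (A (M a).+2 `|` A (M a).+1) <= mu (A (M a).+2) + mu (A (M a).+1))%E.
    by apply: measureU2.
  apply: le_lt_trans subadd _.
  rewrite (_ : 2^-1 = 4^-1 + 4^-1); last by field.
  by rewrite EFinD; apply: lteD; exact: muA.
have bernoulli a : 1 + a%:R * (s - 1) <= s ^+ a.
  elim: a => [|a IH]; first by rewrite mul0r addr0.
  rewrite exprS; apply: le_trans (ler_wpM2l (ltW s_gt0) IH).
  have : 0 <= a%:R * ((s - 1) * (s - 1)) by rewrite mulr_ge0// -expr2 sqr_ge0.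
  by rewrite -natr1; lra.
have bound a : (0 < a)%N -> c * (a%:R * (s - 1)) <= 2 * l.
  move=> a0; have [x [x0 A2 A1]] := small a.
  have T2 : nrm (Tmean mu q spikes (M a).+2 x) <= l by rewrite leNgt; apply/negP.
  have T1 : nrm (Tmean mu q spikes (M a).+1 x) <= l by rewrite leNgt; apply/negP.
  apply: le_trans (psum_le_Tmean T2 T1).
  have M1 : 1 <= (M a)%:R :> R by rewrite ler1n vbase_gt0.
  have sa := bernoulli a.
  have h0 : 0 <= a%:R * (s - 1) by rewrite mulr_ge0// subr_ge0 ltW// growth_ratio_gt1.
  apply: (@le_trans _ _ (c / (M a)%:R * ((M a)%:R * s ^+ a - 1))).
    rewrite mulrAC ler_pdivlMr// -mulrA ler_pM2l//; nra.
  apply: ler_pM; [by rewrite divr_ge0 ?(ltW c0)| |exact: qc (vbase_gt0 a m2)|].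
    by nra.
  exact: psum_spikes_ge.
have d0 : 0 < c * (s - 1) by rewrite mulr_gt0// subr_gt0 growth_ratio_gt1.
have := bound (Num.truncn (2 * l / (c * (s - 1)))).+1 (ltn0Sn _).
apply/negP; rewrite -ltNge mulrCA -ltr_pdivrMr//.
exact: truncnS_gt.
Qed.

End counterexample.

Theorem theorem1 (R : realType) (m : nat -> nat) (hm : bounded_vilenkin m)
    (mu : probability (vgroup m) R) (hmu : is_product_measure mu) :
  (forall q : nat -> R,
     nonincreasing_seq q -> (forall k, 0 <= q k) -> 0 < q 0%N ->
     exists C : R, forall f : nat -> vgroup m -> R[i],
       hardy mu 2^-1 f ->
       (weakLnorm mu 2^-1 (Tmaximal mu q f) <= C%:E * Hnorm mu 2^-1 f)%E) /\
  (forall (p : R) (q : nat -> R),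
     0 < p -> p < 2^-1 ->
     nonincreasing_seq q -> (forall k, 0 <= q k) -> 0 < q 0%N ->
     (exists c : R, 0 < c /\ forall n : nat, (0 < n)%N ->
        c / n%:R <= q n.+1 / Qsum q n.+2) ->
     exists f : nat -> vgroup m -> R[i],
       hardy mu p f /\
       ereal_sup [set weakLnorm mu p (cabs (Tmean mu q f n))
                 | n in [set n | (0 < n)%N]] = +oo%E).
Proof.
case: hm => m2 [B mB]; split=> [q q_mono q_ge0 q0|p q p0 p_lt q_mono q_ge0 q0 [c [c0 qc]]].
  exists (weak_cst R B `^ (2^-1)^-1) => f [/(is_martingaleP m2 hmu) mf _].
  exact: (weak_type_Tmaximal m2 hmu mf q_mono q_ge0 q0 mB).
exists (spikes p); split; first exact: (spikes_hardy m2 hmu p0 p_lt).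
exact: (unbounded_Tmeans m2 hmu p0 p_lt q_ge0 q0 c0 qc).
Qed.
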